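(* Let $\mathcal{A}$ be an abelian category with enough projective objects. Let $d\ge0$ be an integer, and let $\mathcal{X}$ be a resolving subcategory of $\mathcal{A}$ containing the $d$-th syzygies of objects in $\mathcal{A}$. Then $$\mathcal{X}\text{-}\mathrm{tri.dim}\,\mathsf{D}^{\mathrm{b}}(\mathcal{A})\leq\max\{1,d\}.$$
   Context: All subcategories are full and closed under isomorphisms. $\mathrm{proj}\,\mathcal{A}$ is the subcategory of projective objects. $\mathsf{D}^{\mathrm{b}}(\mathcal{A})$ is the bounded derived category; objects of $\mathcal{A}$ are regarded as complexes in degree $0$. A subcategory $\mathcal{X}$ of $\mathcal{A}$ is resolving if it contains $\mathrm{proj}\,\mathcal{A}$, is closed under direct summands, and for every exact sequence $0\to L\to M\to N\to0$ in $\mathcal{A}$ with $N\in\mathcal{X}$ one has $L\in\mathcal{X}$ if and only if $M\in\mathcal{X}$. For $d\ge1$, a $d$-th syzygy of $C\in\mathcal{A}$ is an object $X$ admitting an exact sequence $0\to X\to P_{d-1}\to\cdots\to P_0\to C\to0$ with all $P_i\in\mathrm{proj}\,\mathcal{A}$; the $0$-th syzygy of $C$ is $C$. Relative dimension: for subcategories $\mathcal{X},\mathcal{Y}$ of a triangulated category $\mathcal{T}$, $\mathcal{X}*\mathcal{Y}$ is the subcategory of objects $M$ admitting an exact triangle $X\to M\to Y\to X[1]$ with $X\in\mathcal{X}$, $Y\in\mathcal{Y}$ (this operation is associative). $\mathrm{add}\,\mathcal{X}$ is the smallest subcategory containing $\mathcal{X}$ closed under finite direct sums and direct summands. Put $\langle\mathcal{X}\rangle=\mathrm{add}\{X[i]\mid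 X\in\mathcal{X},\,i\in\mathbb{Z}\}$ and, for $n\ge 1$, $\langle\mathcal{X}\rangle_n=\mathrm{add}(\langle\mathcal{X}\rangle*\cdots*\langle\mathcal{X}\rangle)$ ($n$ factors). Then $\mathcal{X}\text{-}\mathrm{tri.dim}\,\mathcal{T}:=\inf\{n\ge0\mid\mathcal{T}=\langle\mathcal{X}\rangle_{n+1}\}$ (with value $\infty$ if there is no such $n$). *)

(* Defs.v *)
From mathcomp Require Import all_boot all_order all_algebra.
From mathcomp Require Import boolp classical_sets constructive_ereal.
From mathcomp Require Import zify.

Set Implicit Arguments.
Unset Strict Implicit.
Unset Printing Implicit Defensive.

Import Order.TTheory GRing.Theory Num.Theory.
Local Open Scope ring_scope.

Record preadditive := Preadditive {
  Ob :> Type;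
  Hom : Ob -> Ob -> zmodType;
  idm : forall X : Ob, Hom X X;
  comp : forall X Y Z : Ob, Hom Y Z -> Hom X Y -> Hom X Z;
  compA : forall (X Y Z T : Ob) (h : Hom Z T) (g : Hom Y Z) (f : Hom X Y),
    comp h (comp g f) = comp (comp h g) f;
  comp1m : forall (X Y : Ob) (f : Hom X Y), comp (idm Y) f = f;
  compm1 : forall (X Y : Ob) (f : Hom X Y), comp f (idm X) = f;
  compDl : forall (X Y Z : Ob) (g g' : Hom Y Z) (f : Hom X Y),
    comp (g + g') f = comp g f + comp g' f;
  compDr : forall (X Y Z : Ob) (g : Hom Y Z) (f f' : Hom X Y),
    comp g (f + f') = comp g f + comp g f' }.

Arguments Hom {p} X Y.
Arguments idm {p} X.
Arguments comp {p X Y Z} g f.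

Notation "g \c f" := (comp g f) (at level 40, left associativity).

Section Preadditive.
Variable C : preadditive.
Implicit Types X Y Z : C.

Lemma comp0m X Y Z (f : Hom X Y) : (0 : Hom Y Z) \c f = 0.
Proof. by apply: (@addrI _ ((0 : Hom Y Z) \c f)); rewrite -compDl !addr0. Qed.

Lemma compm0 X Y Z (g : Hom Y Z) : g \c (0 : Hom X Y) = 0.
Proof. by apply: (@addrI _ (g \c (0 : Hom X Y))); rewrite -compDr !addr0. Qed.

Lemma compNm X Y Z (g : Hom Y Z) (f : Hom X Y) : (- g) \c f = - (g \c f).
Proof. by apply: (@addrI _ (g \c f)); rewrite -compDl !subrr comp0m. Qed.

Lemma compmN X Y Z (g : Hom Y Z) (f : Hom X Y) : g \c (- f) = - (g \c f).
Proof. by apply: (@addrI _ (g \c f)); rewrite -compDr !subrr compm0. Qed.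

Lemma compMzl X Y Z (g : Hom Y Z) (f : Hom X Y) (n : nat) :
  (g *~ ((-1) ^+ n)) \c f = (g \c f) *~ ((-1) ^+ n).
Proof.
by rewrite -signr_odd; case: odd; rewrite ?expr1 ?expr0 ?mulrN1z ?mulr1z ?compNm.
Qed.

Lemma compMzr X Y Z (g : Hom Y Z) (f : Hom X Y) (n : nat) :
  g \c (f *~ ((-1) ^+ n)) = (g \c f) *~ ((-1) ^+ n).
Proof.
by rewrite -signr_odd; case: odd; rewrite ?expr1 ?expr0 ?mulrN1z ?mulr1z ?compmN.
Qed.

Definition is_iso X Y (f : Hom X Y) : Prop :=
  exists g : Hom Y X, g \c f = idm X /\ f \c g = idm Y.

Definition isomorphic X Y : Prop := exists f : Hom X Y, is_iso f.

Definition mono X Y (f : Hom X Y) : Prop :=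
  forall (T : C) (u v : Hom T X), f \c u = f \c v -> u = v.

Definition epi X Y (f : Hom X Y) : Prop :=
  forall (T : C) (u v : Hom Y T), u \c f = v \c f -> u = v.

Definition is_zero Z : Prop :=
  (forall X (f : Hom X Z), f = 0) /\ (forall X (f : Hom Z X), f = 0).

Definition is_biproduct X Y S (i1 : Hom X S) (i2 : Hom Y S)
    (p1 : Hom S X) (p2 : Hom S Y) : Prop :=
  [/\ p1 \c i1 = idm X, p2 \c i2 = idm Y, p1 \c i2 = 0, p2 \c i1 = 0
    & i1 \c p1 + i2 \c p2 = idm S].

Definition is_kernel K X Y (k : Hom K X) (f : Hom X Y) : Prop :=
  f \c k = 0 /\
  forall T (h : Hom T X), f \c h = 0 -> exists! u : Hom T K, k \c u = h.

Definition is_cokernel X Y Q (q : Hom Y Q) (f : Hom X Y) : Prop :=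
  q \c f = 0 /\
  forall T (h : Hom Y T), h \c f = 0 -> exists! u : Hom Q T, u \c q = h.

Record is_abelian : Prop := IsAbelian {
  ab_zero : exists Z, is_zero Z;
  ab_biproduct : forall X Y, exists S (i1 : Hom X S) (i2 : Hom Y S)
    (p1 : Hom S X) (p2 : Hom S Y), is_biproduct i1 i2 p1 p2;
  ab_kernel : forall X Y (f : Hom X Y), exists K (k : Hom K X), is_kernel k f;
  ab_cokernel : forall X Y (f : Hom X Y),
    exists Q (q : Hom Y Q), is_cokernel q f;
  ab_mono : forall X Y (f : Hom X Y), mono f ->
    exists Z (g : Hom Y Z), is_kernel f g;
  ab_epi : forall X Y (f : Hom X Y), epi f ->
    exists Z (g : Hom Z X), is_cokernel f g }.

End Preadditive.

Record abelian := Abelian {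
  ab_cat :> preadditive;
  abP : is_abelian ab_cat }.

Section Abelian.
Variable A : abelian.
Implicit Types X Y Z : A.

Definition zob : A := projT1 (cid (ab_zero (abP A))).

Lemma zobP : is_zero zob.
Proof. exact: projT2 (cid (ab_zero (abP A))). Qed.

Definition ker X Y (f : Hom X Y) : A := projT1 (cid (ab_kernel (abP A) f)).

Definition kerm X Y (f : Hom X Y) : Hom (ker f) X :=
  projT1 (cid (projT2 (cid (ab_kernel (abP A) f)))).

Lemma kermP X Y (f : Hom X Y) : is_kernel (kerm f) f.
Proof. exact: projT2 (cid (projT2 (cid (ab_kernel (abP A) f)))). Qed.

Definition cok X Y (f : Hom X Y) : A := projT1 (cid (ab_cokernel (abP A) f)).

Definition cokm X Y (f : Hom X Y) : Hom Y (cok f) :=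
  projT1 (cid (projT2 (cid (ab_cokernel (abP A) f)))).

Lemma cokmP X Y (f : Hom X Y) : is_cokernel (cokm f) f.
Proof. exact: projT2 (cid (projT2 (cid (ab_cokernel (abP A) f)))). Qed.

Record biproduct X Y := Biproduct {
  bp : A;
  bi1 : Hom X bp; bi2 : Hom Y bp; bp1 : Hom bp X; bp2 : Hom bp Y;
  bpP : is_biproduct bi1 bi2 bp1 bp2 }.

Lemma biproduct_ex X Y : exists b : biproduct X Y, True.
Proof.
have [S [i1 [i2 [p1 [p2 h]]]]] := ab_biproduct (abP A) X Y.
by exists (Biproduct h).
Qed.

Definition bip X Y : biproduct X Y := projT1 (cid (biproduct_ex X Y)).

Definition osum X Y : A := bp (bip X Y).
Definition in1 X Y : Hom X (osum X Y) := bi1 (bip X Y).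
Definition in2 X Y : Hom Y (osum X Y) := bi2 (bip X Y).
Definition pr1 X Y : Hom (osum X Y) X := bp1 (bip X Y).
Definition pr2 X Y : Hom (osum X Y) Y := bp2 (bip X Y).

Lemma osumP X Y : is_biproduct (in1 X Y) (in2 X Y) (pr1 X Y) (pr2 X Y).
Proof. exact: bpP. Qed.

(** The [u] with [k \c u = h], resp. [u \c q = h]; it is [0] if there is none. *)

Definition rlift K T X (k : Hom K X) (h : Hom T X) : Hom T K :=
  xget 0 [set u | k \c u = h]%classic.

Definition llift Y Q T (q : Hom Y Q) (h : Hom Y T) : Hom Q T :=
  xget 0 [set u | u \c q = h]%classic.

Lemma kerm_mono X Y (f : Hom X Y) : mono (kerm f).
Proof.
move=> T u v e; have [k0 kU] := kermP f.
have h0 : f \c (kerm f \c u) = 0 by rewrite compA k0 comp0m.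
have [w [_ wU]] := kU _ _ h0.
by rewrite -(wU u erefl) -(wU v (esym e)).
Qed.

Lemma cokm_epi X Y (f : Hom X Y) : epi (cokm f).
Proof.
move=> T u v e; have [k0 kU] := cokmP f.
have h0 : (u \c cokm f) \c f = 0 by rewrite -compA k0 compm0.
have [w [_ wU]] := kU _ _ h0.
by rewrite -(wU u erefl) -(wU v (esym e)).
Qed.

Lemma rliftP X Y T (f : Hom X Y) (h : Hom T X) :
  f \c h = 0 -> kerm f \c rlift (kerm f) h = h.
Proof.
move=> /(proj2 (kermP f)) [u [uP _]].
exact: (@xgetPex _ 0 [set u | kerm f \c u = h]%classic (ex_intro _ u uP)).
Qed.

Lemma lliftP X Y T (f : Hom X Y) (h : Hom Y T) :
  h \c f = 0 -> llift (cokm f) h \c cokm f = h.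
Proof.
move=> /(proj2 (cokmP f)) [u [uP _]].
exact: (@xgetPex _ 0 [set u | u \c cokm f = h]%classic (ex_intro _ u uP)).
Qed.

(** Exactness at the middle object: the image [kerm (cokm f)] of [f] is the
    kernel of [g]. *)
Definition exact X Y Z (f : Hom X Y) (g : Hom Y Z) : Prop :=
  is_kernel (kerm (cokm f)) g.

Definition short_exact X Y Z (f : Hom X Y) (g : Hom Y Z) : Prop :=
  [/\ mono f, exact f g & epi g].

Definition projective P : Prop :=
  forall X Y (e : Hom X Y), epi e ->
  forall f : Hom P Y, exists g : Hom P X, e \c g = f.

Definition enough_projectives : Prop :=
  forall X, exists P (e : Hom P X), projective P /\ epi e.

Definition iso_closed (S : A -> Prop) : Prop :=
  forall X Y, isomorphic X Y -> S X -> S Y.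

Definition direct_summand X Y : Prop :=
  exists Z (i1 : Hom X Y) (i2 : Hom Z Y) (p1 : Hom Y X) (p2 : Hom Y Z),
    is_biproduct i1 i2 p1 p2.

Record resolving (S : A -> Prop) : Prop := Resolving {
  res_iso : iso_closed S;
  res_proj : forall P, projective P -> S P;
  res_summand : forall X Y, direct_summand X Y -> S Y -> S X;
  res_exact : forall L M N (f : Hom L M) (g : Hom M N),
    short_exact f g -> S N -> (S L <-> S M) }.

(** [X] is a [d]-th syzygy of [C]: the exact sequence is
    [0 -> E d.+1 -> E d -> ... -> E 1 -> E 0 -> 0] with [E 0 = C], [E d.+1 = X]
    and [E 1], ..., [E d] projective. For [d = 0] this says that [X] is
    isomorphic to [C]. *)
Definition syzygy (d : nat) (C X : A) : Prop :=
  exists (E : nat -> A) (e : forall i, Hom (E i.+1) (E i)),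
    [/\ E 0%N = C, E d.+1 = X, forall i, (0 < i <= d)%N -> projective (E i)
      & [/\ epi (e 0%N), forall i, (i < d)%N -> exact (e i.+1) (e i)
          & mono (e d)]].

(** Homology of [X -f-> Y -g-> Z], and the map induced on it by the middle
    component [b : Y -> Y'] of a morphism of such diagrams. *)
Definition homology X Y Z (f : Hom X Y) (g : Hom Y Z) : A :=
  cok (rlift (kerm g) f).

Definition homology_map X Y Z (f : Hom X Y) (g : Hom Y Z)
    X' Y' Z' (f' : Hom X' Y') (g' : Hom Y' Z') (b : Hom Y Y') :
    Hom (homology f g) (homology f' g') :=
  llift (cokm (rlift (kerm g) f))
        (cokm (rlift (kerm g') f') \c rlift (kerm g') (b \c kerm g)).

Section HomologyMap.
Variables (X Y Z : A) (f : Hom X Y) (g : Hom Y Z).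
Variables (X' Y' Z' : A) (f' : Hom X' Y') (g' : Hom Y' Z').

Definition hcompat (b : Hom Y Y') : Prop :=
  (exists a : Hom X X', b \c f = f' \c a) /\
  (exists c : Hom Z Z', c \c g = g' \c b).

Hypotheses (gf : g \c f = 0) (gf' : g' \c f' = 0).

Lemma hcompat_lift (b : Hom Y Y') : hcompat b ->
  kerm g' \c rlift (kerm g') (b \c kerm g) = b \c kerm g.
Proof.
case=> _ [c hc]; apply: rliftP.
by rewrite compA -hc -compA (proj1 (kermP g)) compm0.
Qed.

Lemma homology_mapP (b : Hom Y Y') : hcompat b ->
  homology_map f g f' g' b \c cokm (rlift (kerm g) f) =
  cokm (rlift (kerm g') f') \c rlift (kerm g') (b \c kerm g).
Proof.
move=> hb; apply: lliftP; case: (hb) => -[a ha] _.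
suff -> : cokm (rlift (kerm g') f') \c rlift (kerm g') (b \c kerm g)
            \c rlift (kerm g) f
        = cokm (rlift (kerm g') f') \c (rlift (kerm g') f' \c a).
  by rewrite compA (proj1 (cokmP _)) comp0m.
rewrite -compA; congr (_ \c _); apply: (@kerm_mono _ _ g').
by rewrite !compA hcompat_lift // rliftP // -compA rliftP.
Qed.

End HomologyMap.

Lemma homology_map1 X Y Z (f : Hom X Y) (g : Hom Y Z) :
  g \c f = 0 -> homology_map f g f g (idm Y) = idm _.
Proof.
move=> gf.
have h : hcompat f g f g (idm Y).
  by split; [exists (idm X) | exists (idm Z)]; rewrite !comp1m !compm1.
apply: (@cokm_epi _ _ (rlift (kerm g) f)).
rewrite homology_mapP // comp1m -[RHS]compm1; congr (_ \c _).
  by rewrite comp1m.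
by apply: (@kerm_mono _ _ g); rewrite compm1 rliftP // (proj1 (kermP g)).
Qed.

Lemma homology_map_comp
    X Y Z (f : Hom X Y) (g : Hom Y Z)
    X' Y' Z' (f' : Hom X' Y') (g' : Hom Y' Z')
    X2 Y2 Z2 (f2 : Hom X2 Y2) (g2 : Hom Y2 Z2) (b : Hom Y Y') (b' : Hom Y' Y2) :
  g \c f = 0 -> g' \c f' = 0 -> g2 \c f2 = 0 ->
  hcompat f g f' g' b -> hcompat f' g' f2 g2 b' ->
  homology_map f g f2 g2 (b' \c b) =
  homology_map f' g' f2 g2 b' \c homology_map f g f' g' b.
Proof.
move=> gf gf' gf2 hb hb'.
have hc : hcompat f g f2 g2 (b' \c b).
  case: hb hb' => -[a ha] [c hc] [[a' ha'] [c' hc']]; split.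
    by exists (a' \c a); rewrite -compA ha compA ha' compA.
  by exists (c' \c c); rewrite -compA hc compA hc' compA.
apply: (@cokm_epi _ _ (rlift (kerm g) f)).
rewrite homology_mapP // -[RHS]compA homology_mapP // [RHS]compA.
rewrite homology_mapP // -[RHS]compA.
congr (_ \c _); apply: (@kerm_mono _ _ g2).
rewrite (hcompat_lift hc) [RHS]compA (hcompat_lift hb') -[RHS]compA.
by rewrite (hcompat_lift hb) compA.
Qed.

Lemma is_iso_comp X Y Z (g : Hom Y Z) (f : Hom X Y) :
  is_iso g -> is_iso f -> is_iso (g \c f).
Proof.
move=> [g' [g1 g2]] [f' [f1 f2]]; exists (f' \c g'); split.
  by rewrite compA -(compA f') g1 compm1.
by rewrite compA -(compA g) f2 compm1.
Qed.

Lemma homology_mapN X Y Z (f : Hom X Y) (g : Hom Y Z)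
    X' Y' Z' (f' : Hom X' Y') (g' : Hom Y' Z') (b : Hom Y Y') :
  g \c f = 0 -> g' \c f' = 0 -> hcompat f g f' g' b ->
  is_iso (homology_map f g f' g' b) ->
  is_iso (homology_map (- f) (- g) (- f') (- g') b).
Proof.
move=> gf gf' hb isob.
have N0 X1 Y1 Z1 (f1 : Hom X1 Y1) (g1 : Hom Y1 Z1) :
    g1 \c f1 = 0 -> (- g1) \c (- f1) = 0.
  by move=> e; rewrite compNm compmN e !oppr0.
have c1 X1 Y1 Z1 (f1 : Hom X1 Y1) (g1 : Hom Y1 Z1) :
    hcompat f1 g1 (- f1) (- g1) (idm Y1).
  split; [exists (- idm X1) | exists (- idm Z1)];
  by rewrite ?compNm ?compmN ?comp1m ?compm1 ?opprK.
have c2 X1 Y1 Z1 (f1 : Hom X1 Y1) (g1 : Hom Y1 Z1) :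
    hcompat (- f1) (- g1) f1 g1 (idm Y1).
  split; [exists (- idm X1) | exists (- idm Z1)];
  by rewrite ?compNm ?compmN ?comp1m ?compm1 ?opprK.
have i1 X1 Y1 Z1 (f1 : Hom X1 Y1) (g1 : Hom Y1 Z1) : g1 \c f1 = 0 ->
    is_iso (homology_map f1 g1 (- f1) (- g1) (idm Y1)) /\
    is_iso (homology_map (- f1) (- g1) f1 g1 (idm Y1)).
  move=> e; have e' := N0 _ _ _ _ _ e.
  have k1 : homology_map (- f1) (- g1) f1 g1 (idm Y1) \c
            homology_map f1 g1 (- f1) (- g1) (idm Y1) = idm _.
    by rewrite -homology_map_comp // comp1m homology_map1.
  have k2 : homology_map f1 g1 (- f1) (- g1) (idm Y1) \c
            homology_map (- f1) (- g1) f1 g1 (idm Y1) = idm _.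
    by rewrite -homology_map_comp // comp1m homology_map1.
  by split; eexists; split; [exact: k1 | exact: k2 | exact: k2 | exact: k1].
have e1 : hcompat (- f) (- g) f' g' b.
  case: hb => -[a ha] [c hc]; split; [exists (- a) | exists (- c)].
    by rewrite !compmN ha.
  by rewrite compNm compmN opprK.
have -> : homology_map (- f) (- g) (- f') (- g') b =
    homology_map f' g' (- f') (- g') (idm Y') \c
    (homology_map f g f' g' b \c homology_map (- f) (- g) f g (idm Y)).
  rewrite -homology_map_comp // ?compm1; try by [apply: N0].
  rewrite -homology_map_comp // ?comp1m //; exact: N0.
apply: is_iso_comp; first by case: (i1 _ _ _ f' g').
by apply: is_iso_comp => //; case: (i1 _ _ _ f g).
Qed.

End Abelian.

#[local] Obligation Tactic := idtac.

Section Complexes.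
Variable A : abelian.

(** The differential is given as a family over all pairs of degrees that
    vanishes off [j = i + 1]; this avoids transports along equalities of
    degrees. *)
Record cplx := Cplx {
  cob :> int -> A;
  cd : forall i j : int, Hom (cob i) (cob j);
  cd_shape : forall i j, j != i + 1 -> cd i j = 0;
  cdd : forall i j l, cd j l \c cd i j = 0;
  cbounded : exists N : nat, forall i : int, (N < `|i|)%N -> is_zero (cob i) }.

Record cmap (X Y : cplx) := Cmap {
  cmor :> forall i, Hom (X i) (Y i);
  cmor_comm : forall i j, cmor j \c cd X i j = cd Y i j \c cmor i }.

Program Definition cmap_id (X : cplx) : cmap X X :=
  @Cmap X X (fun i => idm (X i)) _.
Next Obligation. by move=> X i j; rewrite comp1m compm1. Qed.

Program Definition cmap_comp (X Y Z : cplx) (g : cmap Y Z) (f : cmap X Y) :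
  cmap X Z := @Cmap X Z (fun i => g i \c f i) _.
Next Obligation.
by move=> X Y Z g f i j; rewrite -compA cmor_comm compA cmor_comm compA.
Qed.

Definition coh_map (X Y : cplx) (f : cmap X Y) (n : int) :=
  homology_map (cd X (n - 1) n) (cd X n (n + 1))
               (cd Y (n - 1) n) (cd Y n (n + 1)) (f n).

Definition qis (X Y : cplx) (f : cmap X Y) : Prop :=
  forall n, is_iso (coh_map f n).

Program Definition stalk (X : A) : cplx :=
  @Cplx (fun i => if i == 0 then X else zob A) (fun _ _ => 0) _ _ _.
Next Obligation. by []. Qed.
Next Obligation. by move=> X i j l; rewrite compm0. Qed.
Next Obligation. by move=> X; exists 0%N => i; case: eqP => [->|_ _] //; exact: zobP. Qed.

Program Definition shift (k : int) (X : cplx) : cplx :=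
  @Cplx (fun i => X (i + k))
        (fun i j => cd X (i + k) (j + k) *~ ((-1) ^+ `|k|)) _ _ _.
Next Obligation.
move=> k X i j H /=; rewrite cd_shape ?mul0rz //; apply: contra H => /eqP e.
by apply/eqP/(@addIr _ k); rewrite e addrAC.
Qed.
Next Obligation. by move=> k X i j l /=; rewrite compMzl compMzr cdd !mul0rz. Qed.
Next Obligation.
move=> k X; have [N hN] := cbounded X; exists (N + `|k|)%N => i hi; apply: hN.
by move: hi; lia.
Qed.

Program Definition shift_map (k : int) (X Y : cplx) (f : cmap X Y) :
  cmap (shift k X) (shift k Y) :=
  @Cmap (shift k X) (shift k Y) (fun i => f (i + k)) _.
Next Obligation.
by move=> k X Y f i j /=; rewrite compMzl compMzr cmor_comm.
Qed.

Lemma qis_shift (k : int) (X Y : cplx) (f : cmap X Y) :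
  qis f -> qis (shift_map k f).
Proof.
move=> qf n; rewrite /coh_map /=.
have : is_iso (homology_map (cd X (n - 1 + k) (n + k)) (cd X (n + k) (n + 1 + k))
               (cd Y (n - 1 + k) (n + k)) (cd Y (n + k) (n + 1 + k)) (f (n + k))).
  by rewrite !(addrAC n _ k); exact: qf.
rewrite -signr_odd; case: odd; rewrite ?expr1 ?expr0 ?mulr1z // !mulrN1z.
apply: homology_mapN; rewrite ?cdd //; split.
  by exists (f (n - 1 + k)); rewrite cmor_comm.
by exists (f (n + 1 + k)); rewrite cmor_comm.
Qed.

(** The identity of [X i] transported to [X i -> X j] if [i = j], and [0]
    otherwise. *)
Definition kron (X : int -> A) (i j : int) : Hom (X i) (X j) :=
  if i =P j is ReflectT e then eq_rect i (fun m => Hom (X i) (X m)) (idm (X i)) j e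
  else 0.

Lemma kronE (X : int -> A) i : kron X i i = idm (X i).
Proof. by rewrite /kron; case: eqP => // e; rewrite (eq_irrelevance e erefl). Qed.

Lemma kron0 (X : int -> A) i j : i != j -> kron X i j = 0.
Proof. by rewrite /kron; case: eqP. Qed.

(** The mapping cone: degree [i] is [X (i + 1) (+) Y i], with differential
    [(x, y) |-> (- d x, f x + d y)]. *)
Section Cone.
Variables (X Y : cplx) (f : cmap X Y).

Definition cone_ob (i : int) : A := osum (X (i + 1)) (Y i).

Definition cone_d (i j : int) : Hom (cone_ob i) (cone_ob j) :=
  in1 _ _ \c (- cd X (i + 1) (j + 1)) \c pr1 _ _
  + in2 _ _ \c (f j \c kron X (i + 1) j) \c pr1 _ _
  + in2 _ _ \c cd Y i j \c pr2 _ _.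

Lemma cone_d_in1 i j : cone_d i j \c in1 _ _ =
  in1 _ _ \c (- cd X (i + 1) (j + 1)) + in2 _ _ \c (f j \c kron X (i + 1) j).
Proof.
have [e1 _ _ e2 _] := osumP (X (i + 1)) (Y i).
by rewrite !compDl -!(compA _ (pr1 _ _)) -(compA _ (pr2 _ _)) e1 e2 !compm1
           compm0 addr0.
Qed.

Lemma cone_d_in2 i j : cone_d i j \c in2 _ _ = in2 _ _ \c cd Y i j.
Proof.
have [_ e1 e2 _ _] := osumP (X (i + 1)) (Y i).
by rewrite !compDl -!(compA _ (pr1 _ _)) -(compA _ (pr2 _ _)) e1 e2 !compm0
           compm1 !add0r.
Qed.

Lemma kron_cd i j l :
  f l \c kron X (j + 1) l \c cd X (i + 1) (j + 1) =
  cd Y j l \c f j \c kron X (i + 1) j.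
Proof.
have [el|nl] := eqVneq (j + 1) l; last first.
  by rewrite kron0 // compm0 comp0m cd_shape 1?eq_sym // !comp0m.
have [ej|nj] := eqVneq (i + 1) j.
  by subst l j; rewrite !kronE !compm1 cmor_comm.
rewrite (kron0 X nj) compm0 cd_shape ?compm0 //.
by apply: contra nj => /eqP /addIr ->.
Qed.

Lemma osum_eq (P Q T : A) (u v : Hom (osum P Q) T) :
  u \c in1 _ _ = v \c in1 _ _ -> u \c in2 _ _ = v \c in2 _ _ -> u = v.
Proof.
have [_ _ _ _ e] := osumP P Q => h1 h2.
by rewrite -(compm1 u) -(compm1 v) -e !compDr !compA h1 h2.
Qed.

Program Definition cone : cplx := @Cplx cone_ob cone_d _ _ _.
Next Obligation.
move=> i j nij; rewrite /cone_d !cd_shape ?kron0 //; last 2 first.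
- by rewrite eq_sym.
- by apply: contra nij => /eqP /addIr ->.
by rewrite oppr0 !compm0 !comp0m !addr0.
Qed.
Next Obligation.
move=> i j l; apply: osum_eq; rewrite comp0m -compA.
  rewrite cone_d_in1 compDr !compA cone_d_in1 cone_d_in2.
  rewrite compDl !compmN !compNm -!compA cdd !compm0 oppr0 oppr0.
  by rewrite add0r (compA (f l)) kron_cd -(compA (cd Y j l)) addNr.
by rewrite cone_d_in2 compA cone_d_in2 -compA cdd compm0.
Qed.
Next Obligation.
have [N hN] := cbounded X; have [M hM] := cbounded Y.
exists (N + M + 1)%N => i hi.
have [zX1 zX2] : is_zero (X (i + 1)) by apply: hN; lia.
have [zY1 zY2] : is_zero (Y i) by apply: hM; lia.
have id0 : idm (cone_ob i) = 0.
  by apply: osum_eq; rewrite comp1m comp0m; [exact: zX2 | exact: zY2].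
by split=> Z g; [rewrite -[g]comp1m | rewrite -[g]compm1]; rewrite id0
  ?comp0m ?compm0.
Qed.

Program Definition cone_in : cmap Y cone :=
  @Cmap Y cone (fun i => in2 (X (i + 1)) (Y i)) _.
Next Obligation. by move=> i j /=; rewrite cone_d_in2. Qed.

Program Definition cone_out : cmap cone (shift 1 X) :=
  @Cmap cone (shift 1 X) (fun i => pr1 (X (i + 1)) (Y i)) _.
Next Obligation.
move=> i j /=; rewrite expr1 mulrN1z.
have [e1 _ e2 _ _] := osumP (X (j + 1)) (Y j).
have [e3 _ e4 _ _] := osumP (X (i + 1)) (Y i).
apply: osum_eq; rewrite -!compA ?cone_d_in1 ?cone_d_in2 ?compDr !compA.
  by rewrite e1 e2 -[RHS]compA e3 comp1m compm1 !comp0m addr0.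
by rewrite e2 -[RHS]compA e4 comp0m compm0.
Qed.

End Cone.
End Complexes.

(** The bounded derived category is the localization of the category of bounded
    complexes at the quasi-isomorphisms, in the form of Gabriel and Zisman: its
    objects are the bounded complexes, its morphisms are the formal composites
    of chain maps and of formal inverses of quasi-isomorphisms, and two of these
    are equal when they are related by [deq]. *)

Section Derived.
Variable A : abelian.
Implicit Types X Y Z T M N : cplx A.

Inductive dhom : cplx A -> cplx A -> Type :=
| dmap X Y (f : cmap X Y) : dhom X Y
| dinv X Y (s : cmap X Y) (hs : qis s) : dhom Y X
| dcomp X Y Z (g : dhom Y Z) (f : dhom X Y) : dhom X Z.

Definition did X : dhom X X := dmap (cmap_id X).

Inductive deq : forall X Y, dhom X Y -> dhom X Y -> Prop :=
| deq_refl X Y (f : dhom X Y) : deq f f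
| deq_sym X Y (f g : dhom X Y) : deq f g -> deq g f
| deq_trans X Y (f g h : dhom X Y) : deq f g -> deq g h -> deq f h
| deq_comp X Y Z (g g' : dhom Y Z) (f f' : dhom X Y) :
    deq g g' -> deq f f' -> deq (dcomp g f) (dcomp g' f')
| deq_compA X Y Z T (h : dhom Z T) (g : dhom Y Z) (f : dhom X Y) :
    deq (dcomp h (dcomp g f)) (dcomp (dcomp h g) f)
| deq_comp1m X Y (f : dhom X Y) : deq (dcomp (did Y) f) f
| deq_compm1 X Y (f : dhom X Y) : deq (dcomp f (did X)) f
| deq_map X Y Z (g : cmap Y Z) (f : cmap X Y) :
    deq (dmap (cmap_comp g f)) (dcomp (dmap g) (dmap f))
| deq_invl X Y (s : cmap X Y) (hs : qis s) :
    deq (dcomp (dinv hs) (dmap s)) (did X)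
| deq_invr X Y (s : cmap X Y) (hs : qis s) :
    deq (dcomp (dmap s) (dinv hs)) (did Y).

Fixpoint dshift (k : int) X Y (f : dhom X Y) : dhom (shift k X) (shift k Y) :=
  match f with
  | dmap _ _ f => dmap (shift_map k f)
  | dinv _ _ _ hs => dinv (qis_shift k hs)
  | dcomp _ _ _ g f => dcomp (dshift k g) (dshift k f)
  end.

Definition diso X Y (f : dhom X Y) : Prop :=
  exists g : dhom Y X, deq (dcomp g f) (did X) /\ deq (dcomp f g) (did Y).

Definition disomorphic X Y : Prop := exists f : dhom X Y, diso f.

Definition dzero Z : Prop :=
  (forall X (f g : dhom X Z), deq f g) /\ (forall X (f g : dhom Z X), deq f g).

(** In an additive category the finite direct sums are the finite
    coproducts. *)
Definition dsum X Y S : Prop :=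
  exists (i1 : dhom X S) (i2 : dhom Y S), forall T (f : dhom X T) (g : dhom Y T),
    exists h : dhom S T,
      [/\ deq (dcomp h i1) f, deq (dcomp h i2) g
        & forall h' : dhom S T, deq (dcomp h' i1) f -> deq (dcomp h' i2) g ->
            deq h' h].

(** [X -u-> Y -v-> Z -w-> X[1]] is exact when it is isomorphic to the triangle
    of the mapping cone of a chain map. *)
Definition exact_triangle X Y Z (u : dhom X Y) (v : dhom Y Z)
    (w : dhom Z (shift 1 X)) : Prop :=
  exists (C D : cplx A) (f : cmap C D)
         (a : dhom X C) (b : dhom Y D) (c : dhom Z (cone f)),
    [/\ diso a, diso b & diso c] /\
    [/\ deq (dcomp b u) (dcomp (dmap f) a),
        deq (dcomp c v) (dcomp (dmap (cone_in f)) b)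
      & deq (dcomp (dshift 1 a) w) (dcomp (dmap (cone_out f)) c)].

Definition star (S T : cplx A -> Prop) (M : cplx A) : Prop :=
  exists X Y (u : dhom X M) (v : dhom M Y) (w : dhom Y (shift 1 X)),
    [/\ S X, T Y & exact_triangle u v w].

Inductive add (S : cplx A -> Prop) : cplx A -> Prop :=
| add_incl M : S M -> add S M
| add_iso M N : disomorphic M N -> add S M -> add S N
| add_zero Z : dzero Z -> add S Z
| add_sum X Y M : dsum X Y M -> add S X -> add S Y -> add S M
| add_summand X Y M : dsum X Y M -> add S M -> add S X.

Definition shifts (S : cplx A -> Prop) (M : cplx A) : Prop :=
  exists (X : cplx A) (i : int), S X /\ disomorphic M (shift i X).

(** [gen S n] is [<S>_n] for [n >= 1]; the iterated product has [n] factors. *)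
Definition gen (S : cplx A -> Prop) (n : nat) : cplx A -> Prop :=
  add (iter n.-1 (star (add (shifts S))) (add (shifts S))).

Definition tri_dim (S : cplx A -> Prop) : \bar int :=
  if pselect (exists n : nat, `[< forall M, gen S n.+1 M >]) is left h
  then (Posz (ex_minn h))%:E else +oo%E.

Definition in_deg0 (S : A -> Prop) (M : cplx A) : Prop :=
  exists X : A, S X /\ disomorphic M (stalk X).

End Derived.

(* Main.v *)
From mathcomp Require Import all_boot all_order all_algebra.
From mathcomp Require Import boolp classical_sets constructive_ereal.
From mathcomp Require Import zify.
From Corelib Require Import Setoid Morphisms.
Require Import Defs.

(** Write [Z], [B] for the kernels and images of the differentials of a bounded
    complex, and call a complex [n]-good if all its [Z] and [B] are [n]-th
    syzygies.

    - Let [P i -> N i] be projective covers. The pullbacks of [P (i + 1)] and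
      [P i] over [N (i + 1)] form a complex quasi-isomorphic to [N], whose [Z]
      and [B] are first syzygies of the images and of the cokernels of the
      differentials of [N]. In particular every complex is isomorphic to a
      1-good one.
    - If [M] is [n]-good, let [Q] be a complex with zero differential and
      projective terms covering [Z M]. In the cone of [Q -> M] the images of the
      differentials are the [Z] of [M], and the cokernels are the [B] of [M] plus
      projectives; so by the first point the cone is isomorphic to an
      [(n + 1)]-good complex.
    - If all [Z] and [B] of [M] lie in [X], then [M] is an extension of two
      complexes with zero differential and terms in [X], which are sums of shifts
      of objects of [X].

    With [m = max 1 d], going from 1-good to [m]-good takes [m - 1] cones, and the
    last point contributes two more factors, [m + 1] in total. *)

Set Implicit Arguments.
Unset Strict Implicit.
Unset Printing Implicit Defensive.

Import Order.TTheory GRing.Theory Num.Theory.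
Local Open Scope ring_scope.

Section Chase.
Variable A : abelian.
Implicit Types X Y Z T : A.

Lemma compBl X Y Z (g g' : Hom Y Z) (f : Hom X Y) :
  (g - g') \c f = g \c f - g' \c f.
Proof. by rewrite compDl compNm. Qed.

Lemma compBr X Y Z (g : Hom Y Z) (f f' : Hom X Y) :
  g \c (f - f') = g \c f - g \c f'.
Proof. by rewrite compDr compmN. Qed.

Lemma monoP X Y (f : Hom X Y) :
  mono f <-> forall T (x : Hom T X), f \c x = 0 -> x = 0.
Proof.
split=> [mf T x e|h T u v e]; first by apply: mf; rewrite e compm0.
by apply/eqP; rewrite -subr_eq0; apply/eqP/h; rewrite compBr e subrr.
Qed.

Lemma epiP X Y (f : Hom X Y) :
  epi f <-> forall T (x : Hom Y T), x \c f = 0 -> x = 0.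
Proof.
split=> [mf T x e|h T u v e]; first by apply: mf; rewrite e comp0m.
by apply/eqP; rewrite -subr_eq0; apply/eqP/h; rewrite compBl e subrr.
Qed.

Lemma epi_comp X Y Z (g : Hom Y Z) (f : Hom X Y) : epi g -> epi f -> epi (g \c f).
Proof. by move=> eg ef T u v; rewrite !compA => /ef /eg. Qed.

Lemma mono_comp X Y Z (g : Hom Y Z) (f : Hom X Y) :
  mono g -> mono f -> mono (g \c f).
Proof. by move=> mg mf T u v; rewrite -!compA => /mg /mf. Qed.

Lemma epi_of_comp X Y Z (g : Hom Y Z) (f : Hom X Y) : epi (g \c f) -> epi g.
Proof. by move=> h T u v e; apply: h; rewrite !compA e. Qed.

Lemma mono_of_comp X Y Z (g : Hom Y Z) (f : Hom X Y) : mono (g \c f) -> mono f.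
Proof. by move=> h T u v e; apply: h; rewrite -!compA e. Qed.

Lemma epi_id X : epi (idm X).
Proof. by move=> T u v; rewrite !compm1. Qed.

Lemma mono_id X : mono (idm X).
Proof. by move=> T u v; rewrite !comp1m. Qed.

Lemma is_zeroP X : is_zero X <-> idm X = 0.
Proof.
split=> [[h _]|h]; first exact: h.
by split=> Y f; [rewrite -[f]comp1m h comp0m|rewrite -[f]compm1 h compm0].
Qed.

Lemma mono_zero X Y (f : Hom X Y) : mono f -> is_zero Y -> is_zero X.
Proof. by move=> /monoP mf [z _]; apply/is_zeroP/mf/z. Qed.

Lemma epi_zero X Y (f : Hom X Y) : epi f -> is_zero X -> is_zero Y.
Proof. by move=> /epiP mf [_ z]; apply/is_zeroP/mf/z. Qed.

Lemma zero_projective X : is_zero X -> projective X.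
Proof. by move=> [_ z] Y Z e _ f; exists 0; rewrite compm0 (z _ f). Qed.

Section Osum.
Variables X Y : A.

Lemma pr1_in1 : pr1 X Y \c in1 X Y = idm X. Proof. by case: (osumP X Y). Qed.
Lemma pr2_in2 : pr2 X Y \c in2 X Y = idm Y. Proof. by case: (osumP X Y). Qed.
Lemma pr1_in2 : pr1 X Y \c in2 X Y = 0. Proof. by case: (osumP X Y). Qed.
Lemma pr2_in1 : pr2 X Y \c in1 X Y = 0. Proof. by case: (osumP X Y). Qed.
Lemma osum_id : in1 X Y \c pr1 X Y + in2 X Y \c pr2 X Y = idm _.
Proof. by case: (osumP X Y). Qed.

Lemma osum_elt T (x : Hom T (osum X Y)) :
  x = in1 X Y \c (pr1 X Y \c x) + in2 X Y \c (pr2 X Y \c x).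
Proof. by rewrite !compA -compDl osum_id comp1m. Qed.

Lemma osum_ext T (x y : Hom T (osum X Y)) :
  pr1 X Y \c x = pr1 X Y \c y -> pr2 X Y \c x = pr2 X Y \c y -> x = y.
Proof. by move=> h1 h2; rewrite (osum_elt x) (osum_elt y) h1 h2. Qed.

Lemma osum_zero : is_zero X -> is_zero Y -> is_zero (osum X Y).
Proof.
move=> zX zY; apply/is_zeroP/osum_ext; first by rewrite (zX.1 _ (_ \c _)) compm0.
by rewrite (zY.1 _ (_ \c _)) compm0.
Qed.

Lemma osum_projective : projective X -> projective Y -> projective (osum X Y).
Proof.
move=> pX pY U V e ee f.
have [g hg] := pX _ _ e ee (f \c in1 X Y); have [h hh] := pY _ _ e ee (f \c in2 X Y).
exists (g \c pr1 X Y + h \c pr2 X Y).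
by rewrite compDr !compA hg hh -!compA -compDr osum_id compm1.
Qed.

End Osum.

Lemma pr1_in1K X Y T (x : Hom T X) : pr1 X Y \c (in1 X Y \c x) = x.
Proof. by rewrite compA pr1_in1 comp1m. Qed.
Lemma pr2_in2K X Y T (x : Hom T Y) : pr2 X Y \c (in2 X Y \c x) = x.
Proof. by rewrite compA pr2_in2 comp1m. Qed.
Lemma pr1_in2K X Y T (x : Hom T Y) : pr1 X Y \c (in2 X Y \c x) = 0.
Proof. by rewrite compA pr1_in2 comp0m. Qed.
Lemma pr2_in1K X Y T (x : Hom T X) : pr2 X Y \c (in1 X Y \c x) = 0.
Proof. by rewrite compA pr2_in1 comp0m. Qed.

Definition osumE := (pr1_in1K, pr2_in2K, pr1_in2K, pr2_in1K,
  pr1_in1, pr2_in2, pr1_in2, pr2_in1).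

Lemma epi_cokernel_kerm X Y (f : Hom X Y) : epi f -> is_cokernel f (kerm f).
Proof.
move=> /(ab_epi (abP A)) [Z [g [fg0 gU]]]; split; first by case: (kermP f).
move=> T h hk; apply: gU.
have [u [<- _]] := (kermP f).2 _ _ fg0.
by rewrite compA hk comp0m.
Qed.

(** A morphism [y : T -> Y] is treated as an element of [Y], of which the
    composites [y \c e] with an epimorphism [e] are refinements: this says that
    epimorphisms are surjective up to refinement. *)
Lemma epi_lift X Y (f : Hom X Y) T (y : Hom T Y) : epi f ->
  exists T' (e : Hom T' T) (x : Hom T' X), epi e /\ f \c x = y \c e.
Proof.
move=> /epiP ef; pose phi := f \c pr1 X T - y \c pr2 X T.
have ephi : epi phi.
  apply/epiP => S v; rewrite compBr => /(congr1 (fun w => w \c in1 X T)).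
  by rewrite compBl -!compA !osumE !compm0 compm1 subr0 comp0m; exact: ef.
exists (ker phi), (pr2 X T \c kerm phi), (pr1 X T \c kerm phi); split; last first.
  by apply/eqP; rewrite -subr_eq0 !compA -compBl; apply/eqP; case: (kermP phi).
apply/epiP => S u; rewrite compA => h.
have [v [hv _]] := (epi_cokernel_kerm ephi).2 _ _ h.
have : v \c f = 0.
  move: (congr1 (fun w => w \c in1 X T) hv) => /=.
  by rewrite -!compA compBl -!compA !osumE !compm0 compm1 subr0.
move/ef => v0; move: (congr1 (fun w => w \c in2 X T) hv) => /=.
by rewrite v0 comp0m comp0m -compA osumE compm1.
Qed.

Lemma kerm_cokm_epi X Y (f : Hom X Y) (p : Hom X (ker (cokm f))) :
  kerm (cokm f) \c p = f -> epi p.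
Proof.
set m := kerm _ => fE; apply/epiP => S u up0.
have mm : mono m by exact: kerm_mono.
have mk : mono (m \c kerm u) by apply: mono_comp => //; exact: kerm_mono.
have [V [g [gmk gU]]] := ab_mono (abP A) mk.
have [p' [hp' _]] := (kermP u).2 _ _ up0.
have gf : g \c f = 0 by rewrite -fE -hp' !compA -(compA g m) gmk comp0m.
have [g' [hg' _]] := (cokmP f).2 _ _ gf.
have gm : g \c m = 0 by rewrite -hg' -compA (kermP _).1 compm0.
have [t [ht _]] := gU _ _ gm.
have kt : kerm u \c t = idm _ by apply: mm; rewrite compA ht compm1.
by rewrite -[u]compm1 -kt compA (kermP u).1 comp0m.
Qed.

Lemma cokm_lift X Y (f : Hom X Y) T (y : Hom T Y) : cokm f \c y = 0 ->
  exists T' (e : Hom T' T) (x : Hom T' X), epi e /\ f \c x = y \c e.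
Proof.
move=> h; have [p [hp _]] := (kermP (cokm f)).2 _ _ (cokmP f).1.
have [z [hz _]] := (kermP (cokm f)).2 _ _ h.
have [T' [e [x [ee hx]]]] := epi_lift z (kerm_cokm_epi hp).
by exists T', e, x; split=> //; rewrite -hp -compA hx compA hz.
Qed.

Lemma image_fact X Y (f : Hom X Y) :
  exists I (p : Hom X I) (m : Hom I Y), [/\ epi p, mono m & f = m \c p].
Proof.
have [p [hp _]] := (kermP (cokm f)).2 _ _ (cokmP f).1.
exists (ker (cokm f)), p, (kerm (cokm f)); split; [exact: kerm_cokm_epi|exact: kerm_mono|by []].
Qed.

Lemma exactP X Y Z (f : Hom X Y) (g : Hom Y Z) : exact f g <->
  g \c f = 0 /\ forall T (y : Hom T Y), g \c y = 0 ->
    exists T' (e : Hom T' T) (x : Hom T' X), epi e /\ f \c x = y \c e.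
Proof.
have [p [hp _]] := (kermP (cokm f)).2 _ _ (cokmP f).1.
split=> [[gk kU]|[gf h]].
  split=> [|T y gy]; first by rewrite -hp compA gk comp0m.
  apply: cokm_lift; have [u [<- _]] := kU _ _ gy.
  by rewrite compA (kermP _).1 comp0m.
split.
  have /epiP ep := kerm_cokm_epi hp.
  by apply: ep; rewrite -compA hp.
move=> T y /h [T' [e [x [/epiP ee hx]]]].
apply: (kermP (cokm f)).2; apply: ee.
by rewrite -compA -hx compA (cokmP f).1 comp0m.
Qed.

Lemma cokm_exact X Y (f : Hom X Y) : exact f (cokm f).
Proof. by apply/exactP; split=> [|T y]; [case: (cokmP f)|exact: cokm_lift]. Qed.

Lemma balanced X Y (f : Hom X Y) : mono f -> epi f -> is_iso f.
Proof.
move=> mf /epiP ef; have [Z [g [gf gU]]] := ab_mono (abP A) mf.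
have g0 := ef _ _ gf.
have [t [ht _]] : exists! u, f \c u = idm Y by apply: gU; rewrite g0 comp0m.
by exists t; split=> //; apply: mf; rewrite compA ht comp1m compm1.
Qed.

Lemma iso_mono X Y (f : Hom X Y) : is_iso f -> mono f.
Proof. by move=> [g [gf _]]; apply: (@mono_of_comp _ _ _ g); rewrite gf; exact: mono_id. Qed.

Lemma iso_epi X Y (f : Hom X Y) : is_iso f -> epi f.
Proof. by move=> [g [_ fg]]; apply: (@epi_of_comp _ _ _ _ g); rewrite fg; exact: epi_id. Qed.

Section HomologyIso.
Variables (X Y Z : A) (f : Hom X Y) (g : Hom Y Z).
Variables (X' Y' Z' : A) (f' : Hom X' Y') (g' : Hom Y' Z') (b : Hom Y Y').

Definition hmono : Prop := forall T (x : Hom T Y) (y : Hom T X'),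
  g \c x = 0 -> b \c x = f' \c y ->
  exists T' (e : Hom T' T) (w : Hom T' X), epi e /\ f \c w = x \c e.

Definition hepi : Prop := forall T (y : Hom T Y'), g' \c y = 0 ->
  exists T' (e : Hom T' T) (x : Hom T' Y) (w : Hom T' X'),
    [/\ epi e, g \c x = 0 & y \c e = b \c x + f' \c w].

Hypotheses (gf : g \c f = 0) (gf' : g' \c f' = 0).

Lemma homology_isoP : hcompat f g f' g' b ->
  is_iso (homology_map f g f' g' b) <-> hmono /\ hepi.
Proof.
move=> hb; have hE := homology_mapP gf gf' hb; have lE := hcompat_lift hb.
set u := homology_map _ _ _ _ _ in hE *; set bt := rlift _ (b \c _) in hE lE *.
have fE := rliftP gf; have fE' := rliftP gf'.
set ft := rlift _ f in u hE fE *; set ft' := rlift _ f' in u hE fE' *.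
have ep : epi (cokm ft) by exact: cokm_epi.
have ep' : epi (cokm ft') by exact: cokm_epi.
have mk : mono (kerm g) by exact: kerm_mono.
have mk' : mono (kerm g') by exact: kerm_mono.
split=> [iu|[hm he]].
  split=> [T x y gx bx|T y gy].
    have [z [zE _]] := (kermP g).2 _ _ gx.
    have /(iso_mono iu) : u \c (cokm ft \c z) = u \c 0.
      rewrite compA hE -compA compm0.
      suff -> : bt \c z = ft' \c y by rewrite compA (cokmP _).1 comp0m.
      by apply: mk'; rewrite compA lE -compA zE compA fE'.
    case/cokm_lift => T' [e [w [ee hw]]].
    by exists T', e, w; split=> //; rewrite -fE -compA hw compA zE.
  have [z [zE _]] := (kermP g').2 _ _ gy.
  have [T1 [e1 [h [ee1 hh]]]] := epi_lift (cokm ft' \c z) (iso_epi iu).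
  have [T2 [e2 [v [ee2 hv]]]] := epi_lift h ep.
  have : cokm ft' \c (z \c e1 \c e2 - bt \c v) = 0.
    rewrite compBr (compA _ bt) -hE -(compA u) hv (compA u) hh !compA; exact: subrr.
  case/cokm_lift => T3 [e3 [w [ee3 hw]]].
  exists T3, (e1 \c e2 \c e3), (kerm g \c v \c e3), w; split.
  - by apply: epi_comp => //; exact: epi_comp.
  - by rewrite !compA (kermP g).1 !comp0m.
  - rewrite -fE' -(compA _ ft') hw compBl compBr !compA lE zE.
    by rewrite addrC subrK.
apply: balanced.
  apply/monoP => T v uv.
  have [T1 [e1 [z [ee1 hz]]]] := epi_lift v ep.
  have : cokm ft' \c (bt \c z) = 0 by rewrite compA -hE -compA hz compA uv comp0m.
  case/cokm_lift => T2 [e2 [y [ee2 hy]]].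
  have g0 : g \c (kerm g \c z \c e2) = 0 by rewrite !compA (kermP g).1 !comp0m.
  have be : b \c (kerm g \c z \c e2) = f' \c y.
    by rewrite !compA -lE -(compA _ bt) -(compA _ (bt \c z)) -hy compA fE'.
  have [T3 [e3 [w [ee3 hw]]]] := hm _ _ _ g0 be.
  have : v \c (e1 \c (e2 \c e3)) = 0.
    rewrite (compA v) -hz -!compA (_ : z \c (e2 \c e3) = ft \c w).
      by rewrite compA (cokmP _).1 comp0m.
    by apply: mk; rewrite !compA fE hw.
  have : epi (e1 \c (e2 \c e3)) by do 2![apply: epi_comp => //].
  by move=> /epiP h /h.
have [T1 [e1 [z' [ee1 hz']]]] := epi_lift (idm (homology f' g')) ep'.
have g0 : g' \c (kerm g' \c z') = 0 by rewrite compA (kermP _).1 comp0m.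
have [T2 [e2 [x [w [ee2 gx xE]]]]] := he _ _ g0.
have [z [zE _]] := (kermP g).2 _ _ gx.
have zz : z' \c e2 = bt \c z + ft' \c w.
  by apply: mk'; rewrite compDr !compA lE fE' xE -(compA b) zE.
have : u \c (cokm ft \c z) = e1 \c e2.
  rewrite compA hE -compA -[e1]comp1m -hz' -compA zz compDr.
  by rewrite (compA _ ft') (cokmP _).1 comp0m addr0.
move=> h; apply: (@epi_of_comp _ _ _ _ (cokm ft \c z)).
by rewrite h; exact: epi_comp.
Qed.

End HomologyIso.
End Chase.

#[local] Obligation Tactic := idtac.

Section ComplexConstructions.
Variable A : abelian.
Implicit Types X Y Z : cplx A.

Lemma cmapP X Y (f g : cmap X Y) : (forall i, f i = g i) -> f = g.
Proof.
case: f g => [f hf] [g hg] /= e.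
have e' : f = g by apply: functional_extensionality_dep.
by subst g; congr Cmap; exact: Prop_irrelevance.
Qed.

Lemma cmap_comm_next X Y (f : forall i, Hom (X i) (Y i)) :
  (forall i, f (i + 1) \c cd X i (i + 1) = cd Y i (i + 1) \c f i) ->
  forall i j, f j \c cd X i j = cd Y i j \c f i.
Proof.
move=> h i j; have [->|nj] := eqVneq j (i + 1); first exact: h.
by rewrite !cd_shape // comp0m compm0.
Qed.

Definition qis_at X Y (f : cmap X Y) (n : int) :=
  hmono (cd X n (n + 1)) (cd X (n + 1) (n + 1 + 1)) (cd Y n (n + 1)) (f (n + 1)) /\
  hepi (cd X (n + 1) (n + 1 + 1)) (cd Y n (n + 1)) (cd Y (n + 1) (n + 1 + 1))
    (f (n + 1)).

Lemma qisP X Y (f : cmap X Y) : qis f <-> forall n, qis_at f n.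
Proof.
have E n : is_iso (coh_map f (n + 1)) <-> qis_at f n.
  rewrite /coh_map addrK; apply: homology_isoP; rewrite ?cdd //.
  by split; [exists (f n) | exists (f (n + 1 + 1))]; rewrite cmor_comm.
split=> [q n|q n]; first by apply/E/q.
by rewrite -(subrK 1 n); apply/E/q.
Qed.

Lemma qis_id X : qis (cmap_id X).
Proof.
apply/qisP => n; split=> [T x y _|T y gy] /=.
  by rewrite comp1m => ->; exists T, (idm T), y; rewrite compm1; split=> //; exact: epi_id.
exists T, (idm T), y, 0; split=> //; first exact: epi_id.
by rewrite compm1 compm0 comp1m addr0.
Qed.

Section DirectSum.

Program Definition csum X Y : cplx A :=
  @Cplx A (fun i => osum (X i) (Y i))
    (fun i j => in1 _ _ \c cd X i j \c pr1 _ _ + in2 _ _ \c cd Y i j \c pr2 _ _) _ _ _.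
Next Obligation. by move=> X Y i j nij /=; rewrite !cd_shape // !compm0 !comp0m addr0. Qed.
Next Obligation.
move=> X Y i j l /=; apply: osum_ext; rewrite !(compDl, compDr) -!compA !osumE;
by rewrite !compm0 ?addr0 ?add0r compA cdd comp0m.
Qed.
Next Obligation.
move=> X Y; have [N hN] := cbounded X; have [M hM] := cbounded Y.
exists (N + M)%N => i hi; apply: osum_zero; [apply: hN|apply: hM]; move: hi; lia.
Qed.

Lemma pr1_csum X Y i j T (x : Hom T (csum X Y i)) :
  pr1 _ _ \c (cd (csum X Y) i j \c x) = cd X i j \c (pr1 _ _ \c x).
Proof. by rewrite /= compDl compDr -!compA !osumE addr0. Qed.

Lemma pr2_csum X Y i j T (x : Hom T (csum X Y i)) :
  pr2 _ _ \c (cd (csum X Y) i j \c x) = cd Y i j \c (pr2 _ _ \c x).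
Proof. by rewrite /= compDl compDr -!compA !osumE add0r. Qed.

Program Definition csum_map X X' Y Y' (f : cmap X X') (g : cmap Y Y') :
  cmap (csum X Y) (csum X' Y') :=
  @Cmap A (csum X Y) (csum X' Y')
    (fun i => in1 _ _ \c f i \c pr1 _ _ + in2 _ _ \c g i \c pr2 _ _) _.
Next Obligation.
move=> X X' Y Y' f g i j; apply: osum_ext.
  rewrite pr1_csum !compDl !compDr -!compA !osumE !addr0.
  by rewrite !compm0 !addr0 compA cmor_comm compA.
rewrite pr2_csum !compDl !compDr -!compA !osumE !add0r.
by rewrite !compm0 !add0r compA cmor_comm compA.
Qed.

Lemma pr1_csum_map X X' Y Y' (f : cmap X X') (g : cmap Y Y') i T (x : Hom T (csum X Y i)) :
  pr1 _ _ \c (csum_map f g i \c x) = f i \c (pr1 _ _ \c x).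
Proof. by rewrite /= compDl compDr -!compA !osumE addr0. Qed.

Lemma pr2_csum_map X X' Y Y' (f : cmap X X') (g : cmap Y Y') i T (x : Hom T (csum X Y i)) :
  pr2 _ _ \c (csum_map f g i \c x) = g i \c (pr2 _ _ \c x).
Proof. by rewrite /= compDl compDr -!compA !osumE add0r. Qed.

Program Definition csum_in1 X Y : cmap X (csum X Y) :=
  @Cmap A X (csum X Y) (fun i => in1 _ _) _.
Next Obligation.
by move=> X Y i j; rewrite /= compDl -!compA !osumE !compm0 addr0 compm1.
Qed.

Program Definition csum_in2 X Y : cmap Y (csum X Y) :=
  @Cmap A Y (csum X Y) (fun i => in2 _ _) _.
Next Obligation.
by move=> X Y i j; rewrite /= compDl -!compA !osumE !compm0 add0r compm1.
Qed.

Program Definition codiag X : cmap (csum X X) X :=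
  @Cmap A (csum X X) X (fun i => pr1 _ _ + pr2 _ _) _.
Next Obligation.
by move=> X i j /=; rewrite compDr !compDl !compDr -!compA !osumE addr0 add0r.
Qed.

Lemma qis_csum X X' Y Y' (f : cmap X X') (g : cmap Y Y') :
  qis f -> qis g -> qis (csum_map f g).
Proof.
move=> /qisP qf /qisP qg; apply/qisP => n; have [mf ef] := qf n; have [mg eg] := qg n.
split=> [T x y gx|T y gy].
  move=> bx.
  have [] := mf T (pr1 _ _ \c x) (pr1 _ _ \c y).
  - by rewrite -pr1_csum gx compm0.
  - by rewrite -(pr1_csum_map f g) bx pr1_csum.
  move=> T1 [e1 [w1 [ee1 h1]]].
  have [] := mg T1 (pr2 _ _ \c x \c e1) (pr2 _ _ \c y \c e1).
  - by rewrite compA -pr2_csum gx compm0 comp0m.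
  - by rewrite compA -(pr2_csum_map f g) bx pr2_csum !compA.
  move=> T2 [e2 [w2 [ee2 h2]]].
  exists T2, (e1 \c e2), (in1 _ _ \c w1 \c e2 + in2 _ _ \c w2); split.
    exact: epi_comp.
  apply: osum_ext.
    by rewrite pr1_csum compDr -!compA !osumE addr0 compA h1 -!compA.
  by rewrite pr2_csum compDr -!compA !osumE add0r h2 -!compA.
have [] := ef T (pr1 _ _ \c y); first by rewrite -pr1_csum gy compm0.
move=> T1 [e1 [x1 [w1 [ee1 h1 k1]]]].
have [] := eg T1 (pr2 _ _ \c y \c e1); first by rewrite compA -pr2_csum gy compm0 comp0m.
move=> T2 [e2 [x2 [w2 [ee2 h2 k2]]]].
exists T2, (e1 \c e2), (in1 _ _ \c x1 \c e2 + in2 _ _ \c x2),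
  (in1 _ _ \c w1 \c e2 + in2 _ _ \c w2); split.
- exact: epi_comp.
- apply: osum_ext.
    by rewrite pr1_csum compDr -!compA !osumE addr0 compA h1 comp0m compm0.
  by rewrite pr2_csum compDr -!compA !osumE add0r h2 compm0.
- apply: osum_ext.
    rewrite compDr pr1_csum_map pr1_csum !compDr -!compA !osumE !compm0 !addr0.
    by rewrite !compA k1 compDl.
  rewrite compDr pr2_csum_map pr2_csum !compDr -!compA !osumE !compm0 !add0r.
  by rewrite !compA k2.
Qed.

End DirectSum.

Section FromSequence.
Variables (V : int -> A) (d : forall i, Hom (V i) (V (i + 1))).
Hypothesis dd : forall i, d (i + 1) \c d i = 0.
Hypothesis bV : exists N : nat, forall i : int, (N < `|i|)%N -> is_zero (V i).

Program Definition seq_cplx : cplx A :=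
  @Cplx A V (fun i j => kron V (i + 1) j \c d i) _ _ bV.
Next Obligation. by move=> i j nij /=; rewrite kron0 ?comp0m // eq_sym. Qed.
Next Obligation.
move=> i j l /=; have [ej|nj] := eqVneq (i + 1) j; last first.
  by rewrite (kron0 V nj) !comp0m compm0.
by subst j; rewrite kronE comp1m -compA dd compm0.
Qed.

Lemma seq_cplxE i : cd seq_cplx i (i + 1) = d i.
Proof. by rewrite /= kronE comp1m. Qed.

End FromSequence.

Section ZeroDifferential.
Variable V : int -> A.
Hypothesis bV : exists N : nat, forall i : int, (N < `|i|)%N -> is_zero (V i).

Program Definition graded : cplx A := @Cplx A V (fun _ _ => 0) _ _ bV.
Next Obligation. by []. Qed.
Next Obligation. by move=> i j l /=; rewrite compm0. Qed.

End ZeroDifferential.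
End ComplexConstructions.

Section DerivedCategory.
Variable A : abelian.
Implicit Types X Y Z : cplx A.

#[local] Instance deq_equiv X Y : Equivalence (@deq A X Y).
Proof.
by split; [exact: deq_refl | move=> f g; exact: deq_sym | move=> f g h; exact: deq_trans].
Qed.

#[local] Instance dcomp_proper X Y Z :
  Proper (@deq A Y Z ==> @deq A X Y ==> @deq A X Z) (@dcomp A X Y Z).
Proof. by move=> g g' hg f f' hf; exact: deq_comp. Qed.

#[local] Hint Resolve deq_refl : core.

Lemma diso_comp X Y Z (g : dhom Y Z) (f : dhom X Y) : diso g -> diso f -> diso (dcomp g f).
Proof.
move=> [g' [g1 g2]] [f' [f1 f2]]; exists (dcomp f' g'); split.
  by rewrite deq_compA -(deq_compA f') g1 deq_compm1.
by rewrite deq_compA -(deq_compA g) f2 deq_compm1.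
Qed.

Lemma diso_id X : diso (did X).
Proof. by exists (did X); split; exact: deq_comp1m. Qed.

Lemma diso_qis X Y (s : cmap X Y) : qis s -> diso (dmap s).
Proof. by move=> hs; exists (dinv hs); split; [exact: deq_invl|exact: deq_invr]. Qed.

Lemma disomorphic_qis X Y (s : cmap X Y) : qis s -> disomorphic X Y.
Proof. by move=> hs; exists (dmap s); exact: diso_qis. Qed.

Lemma disomorphic_sym X Y : disomorphic X Y -> disomorphic Y X.
Proof. by move=> [f [g [gf fg]]]; exists g, f. Qed.

Lemma deq_cancell X Y Z (s : dhom Y Z) (f g : dhom X Y) :
  diso s -> deq (dcomp s f) (dcomp s g) -> deq f g.
Proof.
move=> [t [ts _]] e.
by rewrite -(deq_comp1m f) -(deq_comp1m g) -ts -!deq_compA e.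
Qed.

Lemma deq_cancelr X Y Z (s : dhom X Y) (f g : dhom Y Z) :
  diso s -> deq (dcomp f s) (dcomp g s) -> deq f g.
Proof.
move=> [t [_ st]] e.
by rewrite -(deq_compm1 f) -(deq_compm1 g) -st !deq_compA e.
Qed.

Lemma deq_dmap X Y (f g : cmap X Y) : (forall i, f i = g i) -> deq (dmap f) (dmap g).
Proof. by move=> /cmapP ->; exact: deq_refl. Qed.

Lemma deq_square X Y Y' Z (f : cmap X Y) (g : cmap Y Z) (f' : cmap X Y') (g' : cmap Y' Z) :
  (forall i, g i \c f i = g' i \c f' i) ->
  deq (dcomp (dmap g) (dmap f)) (dcomp (dmap g') (dmap f')).
Proof. by move=> h; rewrite -!deq_map; exact: deq_dmap. Qed.

(** Functors that preserve quasi-isomorphisms act on zigzags, and so do natural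
    transformations between them; applied to direct sums, inclusions and
    codiagonals this shows that a direct sum of complexes is still a coproduct
    after localization. *)
Record qfun := Qfun {
  qob :> cplx A -> cplx A;
  qmap : forall X Y, cmap X Y -> cmap (qob X) (qob Y);
  qmap_id : forall X, qmap (cmap_id X) = cmap_id (qob X);
  qmap_comp : forall X Y Z (g : cmap Y Z) (f : cmap X Y),
    qmap (cmap_comp g f) = cmap_comp (qmap g) (qmap f);
  qmap_qis : forall X Y (f : cmap X Y), qis f -> qis (qmap f) }.

Fixpoint dfun (F : qfun) X Y (f : dhom X Y) : dhom (F X) (F Y) :=
  match f with
  | dmap _ _ f => dmap (qmap F f)
  | dinv _ _ _ hs => dinv (qmap_qis F hs)
  | dcomp _ _ _ g f => dcomp (dfun F g) (dfun F f)
  end.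

#[local] Instance dfun_proper (F : qfun) X Y :
  Proper (@deq A X Y ==> @deq A (F X) (F Y)) (@dfun F X Y).
Proof.
move=> f g; elim=> {f g X Y} /=.
- by [].
- by move=> X Y f g _ e; symmetry.
- by move=> X Y f g h _ e1 _ e2; rewrite e1.
- by move=> X Y Z g g' f f' _ e1 _ e2; rewrite e1 e2.
- by move=> X Y Z T h g f; exact: deq_compA.
- by move=> X Y f; rewrite qmap_id; exact: deq_comp1m.
- by move=> X Y f; rewrite qmap_id; exact: deq_compm1.
- by move=> X Y Z g f; rewrite qmap_comp; exact: deq_map.
- by move=> X Y s hs; rewrite qmap_id; exact: deq_invl.
- by move=> X Y s hs; rewrite qmap_id; exact: deq_invr.
Qed.

Lemma dfun_natural (F G : qfun) (eta : forall X, cmap (F X) (G X)) :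
  (forall X Y (f : cmap X Y) i, eta Y i \c qmap F f i = qmap G f i \c eta X i) ->
  forall X Y (f : dhom X Y),
    deq (dcomp (dmap (eta Y)) (dfun F f)) (dcomp (dfun G f) (dmap (eta X))).
Proof.
move=> h X Y; elim=> {X Y} /= [X Y f|X Y s hs|X Y Z g hg f hf].
- exact: deq_square.
- apply: (deq_cancell (diso_qis (qmap_qis G hs))).
  apply: (deq_cancelr (diso_qis (qmap_qis F hs))).
  rewrite -!deq_compA deq_invl deq_compm1 (deq_compA _ (dinv _)) deq_invr deq_comp1m.
  by symmetry; exact: deq_square.
- by rewrite deq_compA hg -deq_compA hf deq_compA.
Qed.

Lemma csum_map_comp X X' X2 Y Y' Y2 (f : cmap X X') (f' : cmap X' X2) (g : cmap Y Y')
    (g' : cmap Y' Y2) :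
  cmap_comp (csum_map f' g') (csum_map f g) =
  csum_map (cmap_comp f' f) (cmap_comp g' g).
Proof.
apply: cmapP => i; rewrite -[LHS]compm1 -[RHS]compm1; apply: osum_ext.
  by rewrite pr1_csum_map /= -compA !pr1_csum_map compA.
by rewrite pr2_csum_map /= -compA !pr2_csum_map compA.
Qed.

Lemma csum_map_id X Y : csum_map (cmap_id X) (cmap_id Y) = cmap_id (csum X Y).
Proof.
apply: cmapP => i; rewrite -[LHS]compm1; apply: osum_ext.
  by rewrite pr1_csum_map comp1m compm1.
by rewrite pr2_csum_map comp1m compm1.
Qed.

Definition suml (Z : cplx A) : qfun.
Proof.
refine (@Qfun (fun X => csum X Z) (fun X Y f => csum_map f (cmap_id Z)) _ _ _).
- by move=> X; exact: csum_map_id.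
- by move=> X Y T g f; rewrite csum_map_comp; congr csum_map; apply: cmapP => i; rewrite /= comp1m.
- by move=> X Y f qf; apply: qis_csum => //; exact: qis_id.
Defined.

Definition sumr (Z : cplx A) : qfun.
Proof.
refine (@Qfun (fun X => csum Z X) (fun X Y f => csum_map (cmap_id Z) f) _ _ _).
- by move=> X; exact: csum_map_id.
- by move=> X Y T g f; rewrite csum_map_comp; congr csum_map; apply: cmapP => i; rewrite /= comp1m.
- by move=> X Y f qf; apply: qis_csum => //; exact: qis_id.
Defined.

Definition qid : qfun :=
  @Qfun id (fun X Y f => f) (fun X => erefl) (fun X Y T g f => erefl) (fun X Y f q => q).

Lemma dfun_id X Y (f : dhom X Y) : dfun qid f = f.
Proof. by elim: f => {X Y} //= X Y Z g -> f ->. Qed.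

Lemma csum_map_in1 X X' Y Y' (f : cmap X X') (g : cmap Y Y') i :
  csum_map f g i \c csum_in1 X Y i = csum_in1 X' Y' i \c f i.
Proof. by rewrite /= compDl -!compA !osumE !compm0 addr0 compm1. Qed.

Lemma csum_map_in2 X X' Y Y' (f : cmap X X') (g : cmap Y Y') i :
  csum_map f g i \c csum_in2 X Y i = csum_in2 X' Y' i \c g i.
Proof. by rewrite /= compDl -!compA !osumE !compm0 add0r compm1. Qed.

Lemma codiagE X i T (x : Hom T (csum X X i)) :
  codiag X i \c x = pr1 _ _ \c x + pr2 _ _ \c x.
Proof. exact: compDl. Qed.

Lemma codiag_in1 X i : codiag X i \c csum_in1 X X i = idm _.
Proof. by rewrite /= compDl !osumE addr0. Qed.

Lemma codiag_in2 X i : codiag X i \c csum_in2 X X i = idm _.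
Proof. by rewrite /= compDl !osumE add0r. Qed.

Lemma suml_in1 Z X Y (f : dhom X Y) :
  deq (dcomp (dfun (suml Z) f) (dmap (csum_in1 X Z))) (dcomp (dmap (csum_in1 Y Z)) f).
Proof.
have h := @dfun_natural qid (suml Z) (fun X => csum_in1 X Z).
rewrite -h ?dfun_id // => {}X {}Y {}f i.
exact: esym (csum_map_in1 f (cmap_id Z) i).
Qed.

Lemma sumr_in2 Z X Y (f : dhom X Y) :
  deq (dcomp (dfun (sumr Z) f) (dmap (csum_in2 Z X))) (dcomp (dmap (csum_in2 Z Y)) f).
Proof.
have h := @dfun_natural qid (sumr Z) (fun X => csum_in2 Z X).
rewrite -h ?dfun_id // => {}X {}Y {}f i.
exact: esym (csum_map_in2 (cmap_id Z) f i).
Qed.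

Lemma suml_in2 Z X Y (f : dhom X Y) :
  deq (dcomp (dfun (suml Z) f) (dmap (csum_in2 X Z))) (dmap (csum_in2 Y Z)).
Proof.
have h X' Y' (s : cmap X' Y') :
    deq (dcomp (dmap (csum_map s (cmap_id Z))) (dmap (csum_in2 X' Z))) (dmap (csum_in2 Y' Z)).
  by rewrite -deq_map; apply: deq_dmap => i; rewrite [LHS]csum_map_in2 compm1.
elim: f => {X Y} /= [X Y f|X Y s hs|X Y T g hg f hf]; first exact: h.
  by rewrite -(h _ _ s) deq_compA deq_invl deq_comp1m.
by rewrite -deq_compA hf.
Qed.

Lemma sumr_in1 Z X Y (f : dhom X Y) :
  deq (dcomp (dfun (sumr Z) f) (dmap (csum_in1 Z X))) (dmap (csum_in1 Z Y)).
Proof.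
have h X' Y' (s : cmap X' Y') :
    deq (dcomp (dmap (csum_map (cmap_id Z) s)) (dmap (csum_in1 Z X'))) (dmap (csum_in1 Z Y')).
  by rewrite -deq_map; apply: deq_dmap => i; rewrite [LHS]csum_map_in1 compm1.
elim: f => {X Y} /= [X Y f|X Y s hs|X Y T g hg f hf]; first exact: h.
  by rewrite -(h _ _ s) deq_compA deq_invl deq_comp1m.
by rewrite -deq_compA hf.
Qed.

Lemma sum_interchange X X' Z Z' (f : dhom X X') (g : dhom Z Z') :
  deq (dcomp (dfun (suml Z') f) (dfun (sumr X) g))
      (dcomp (dfun (sumr X') g) (dfun (suml Z) f)).
Proof.
elim: g => {Z Z'} /= [Z Z' g|Z' Z s hs|Z Z' Z2 g hg h hh].
- symmetry.
  apply: (dfun_natural (F := suml Z) (G := suml Z') (eta := fun X => csum_map (cmap_id X) g)).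
  move=> {}X {}X' {}f i; move: (csum_map_comp f (cmap_id X') (cmap_id Z) g).
  move/(congr1 (fun h => cmor h i)) => /= ->.
  move: (csum_map_comp (cmap_id X) f g (cmap_id Z')) => /(congr1 (fun h => cmor h i)) /= ->.
  by rewrite !comp1m !compm1.
- apply: (deq_cancell (diso_qis (qmap_qis (sumr X') hs))).
  apply: (deq_cancelr (diso_qis (qmap_qis (sumr X) hs))).
  rewrite -!deq_compA deq_invl deq_compm1 (deq_compA _ (dinv _)) deq_invr deq_comp1m.
  apply: (dfun_natural (F := suml Z') (G := suml Z) (eta := fun X => csum_map (cmap_id X) s)).
  move=> {}X {}X' {}f i; move: (csum_map_comp f (cmap_id X') (cmap_id Z') s).
  move/(congr1 (fun h => cmor h i)) => /= ->.
  move: (csum_map_comp (cmap_id X) f s (cmap_id Z)) => /(congr1 (fun h => cmor h i)) /= ->.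
  by rewrite !comp1m !compm1.
- by rewrite deq_compA hg -deq_compA hh deq_compA.
Qed.

Lemma codiag_natural X Y (f : dhom X Y) :
  deq (dcomp (dmap (codiag Y)) (dcomp (dfun (suml Y) f) (dfun (sumr X) f)))
      (dcomp f (dmap (codiag X))).
Proof.
have h X' Y' (s : cmap X' Y') : deq
    (dcomp (dmap (codiag Y')) (dcomp (dmap (csum_map s (cmap_id Y')))
       (dmap (csum_map (cmap_id X') s))))
    (dcomp (dmap s) (dmap (codiag X'))).
  rewrite -!deq_map; apply: deq_dmap => i.
  rewrite -[LHS]compm1 -[RHS]compm1 -[LHS]compA -[RHS]compA.
  rewrite codiagE -(compA (csum_map s (cmap_id Y') i)).
  rewrite pr1_csum_map pr2_csum_map pr1_csum_map pr2_csum_map.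
  by rewrite !comp1m codiagE compDr.
elim: f => {X Y} /= [X Y f|Y X s hs|X Y T g hg f hf]; first exact: h.
  apply: (deq_cancell (diso_qis hs)).
  rewrite (deq_compA _ (dinv hs)) deq_invr deq_comp1m deq_compA -(h _ _ s).
  have := sum_interchange (dmap s) (dmap s) => /= ->.
  rewrite -!deq_compA (deq_compA _ (dinv (qmap_qis (suml Y) hs))).
  by rewrite deq_invr deq_comp1m deq_invr deq_compm1.
rewrite -!deq_compA (deq_compA (dfun (suml T) f)) sum_interchange.
rewrite -(deq_compA (dfun (sumr Y) g)).
by rewrite -hf (deq_compA g) -hg -!deq_compA.
Qed.

Lemma dsum_csum X Y : dsum X Y (csum X Y).
Proof.
exists (dmap (csum_in1 X Y)), (dmap (csum_in2 X Y)) => T f g.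
have c1 Z : deq (dcomp (dmap (codiag Z)) (dmap (csum_in1 Z Z))) (did Z).
  by rewrite -deq_map; apply: deq_dmap => i; exact: codiag_in1.
have c2 Z : deq (dcomp (dmap (codiag Z)) (dmap (csum_in2 Z Z))) (did Z).
  by rewrite -deq_map; apply: deq_dmap => i; exact: codiag_in2.
exists (dcomp (dmap (codiag T)) (dcomp (dfun (suml T) f) (dfun (sumr X) g))); split.
- by rewrite -!deq_compA sumr_in1 suml_in1 deq_compA c1 deq_comp1m.
- by rewrite -!deq_compA sumr_in2 (deq_compA _ (dmap _) g) suml_in2 deq_compA c2 deq_comp1m.
move=> h' <- <- /=; rewrite -(deq_compA (dfun (suml T) h')).
rewrite (deq_compA (dmap _) (dfun (sumr X) h')).
have := sum_interchange (dmap (csum_in1 X Y)) h' => /= ->.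
rewrite -(deq_compA (dfun (sumr (csum X Y)) h')) (deq_compA (dfun (suml T) h')) (deq_compA (dmap (codiag T))).
rewrite codiag_natural.
rewrite -deq_compA -!deq_map; rewrite -{1}(deq_compm1 h'); apply: deq_comp => //.
symmetry; apply: deq_dmap => i; rewrite -[LHS]compm1 -[LHS]compA codiagE -(compA (csum_map _ _ i)).
rewrite pr1_csum_map pr2_csum_map pr1_csum_map pr2_csum_map !comp1m.
rewrite !compm1; exact: osum_id.
Qed.

Lemma star_cone (S T : cplx A -> Prop) X Y (f : cmap X Y) :
  S X -> T (cone f) -> star S T Y.
Proof.
move=> SX TY; exists X, (cone f), (dmap f), (dmap (cone_in f)), (dmap (cone_out f)).
split=> //; exists X, Y, f, (did X), (did Y), (did (cone f)); split.
  by split; exact: diso_id.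
split; rewrite ?deq_compm1 ?deq_comp1m //=.
rewrite (_ : shift_map 1 (cmap_id X) = cmap_id (shift 1 X)) ?deq_comp1m //.
exact: cmapP.
Qed.

Definition diso_closed (S : cplx A -> Prop) : Prop :=
  forall X Y, disomorphic X Y -> S X -> S Y.

Lemma add_diso (S : cplx A -> Prop) : diso_closed (add S).
Proof. by move=> X Y; exact: add_iso. Qed.

Lemma star_diso (S T : cplx A -> Prop) : diso_closed (star S T).
Proof.
move=> M N [f [g [gf fg]]] [X [Y [u [v [w [SX TY]]]]]].
move=> [C [D [h [a [b [c [[ia ib ic] [e1 e2 e3]]]]]]]].
exists X, Y, (dcomp f u), (dcomp v g), w; split=> //.
exists C, D, h, a, (dcomp b g), c; split; [split=> //|split=> //].
- by apply: diso_comp => //; exists f.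
- by rewrite -deq_compA (deq_compA g) gf deq_comp1m.
- by rewrite deq_compA e2 deq_compA.
Qed.

Lemma iter_star_diso (S : cplx A -> Prop) n : diso_closed (iter n (star (add S)) (add S)).
Proof. by case: n => [|n]; [exact: add_diso|exact: star_diso]. Qed.

Lemma graded_diso (V W : cplx A) :
  (forall i j, cd V i j = 0) -> (forall i j, cd W i j = 0) ->
  (forall i, isomorphic (V i) (W i)) -> disomorphic V W.
Proof.
move=> dV dW iVW; pose f i := projT1 (cid (iVW i)).
pose g i := projT1 (cid (projT2 (cid (iVW i)))).
have gfP i : g i \c f i = idm _ /\ f i \c g i = idm _ := projT2 (cid (projT2 (cid (iVW i)))).
have cf i j : f j \c cd V i j = cd W i j \c f i by rewrite dV dW compm0 comp0m.
have cg i j : g j \c cd W i j = cd V i j \c g i by rewrite dV dW compm0 comp0m.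
exists (dmap (Cmap cf)), (dmap (Cmap cg)); split; rewrite -deq_map;
by apply: deq_dmap => i; case: (gfP i).
Qed.

Lemma isomorphic_refl (X : A) : isomorphic X X.
Proof. by exists (idm X), (idm X); rewrite comp1m. Qed.

Lemma isomorphic_zero (X Y : A) : is_zero X -> is_zero Y -> isomorphic X Y.
Proof.
move=> [_ zX] [_ zY]; exists 0, 0.
by rewrite !comp0m (zX _ (idm X)) (zY _ (idm Y)).
Qed.

Lemma isomorphic_osuml (X Y : A) : is_zero Y -> isomorphic (osum X Y) X.
Proof.
move=> [_ zY]; exists (pr1 X Y), (in1 X Y); rewrite pr1_in1; split=> //.
by rewrite -(osum_id X Y) (zY _ (in2 X Y)) comp0m addr0.
Qed.

Lemma isomorphic_osumr (X Y : A) : is_zero X -> isomorphic (osum X Y) Y.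
Proof.
move=> [_ zX]; exists (pr2 X Y), (in2 X Y); rewrite pr2_in2; split=> //.
by rewrite -(osum_id X Y) (zX _ (in1 X Y)) comp0m add0r.
Qed.

Section GradedInX.
Variable S : A -> Prop.

Lemma graded_shift (V : cplx A) k : (forall i j, cd V i j = 0) ->
  (forall i, i != k -> is_zero (V i)) -> S (V k) -> shifts (in_deg0 S) V.
Proof.
move=> dV zV SV; exists (stalk (V k)), (- k); split.
  by exists (V k); split=> //; exists (did _); exact: diso_id.
apply: graded_diso => // [i j|i] /=; first exact: mul0rz.
case: eqP => [/subr0_eq ->|/eqP nk]; first exact: isomorphic_refl.
by apply: isomorphic_zero; [apply: zV; rewrite -subr_eq0|exact: zobP].
Qed.

Lemma graded_add (V : cplx A) : S (zob A) -> (forall i j, cd V i j = 0) ->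
  (forall i, S (V i)) -> add (shifts (in_deg0 S)) V.
Proof.
move=> S0 dV SV; have [N hN] := cbounded V.
have : forall i, ~~ (- N%:Z <= i < - N%:Z + (2 * N + 1)%N%:Z) -> is_zero (V i).
  by move=> i hi; apply: hN; lia.
elim: (2 * N + 1)%N (- N%:Z) V {hN} dV SV => {N} [|n IH] m V dV SV zV.
  apply/add_incl/(@graded_shift _ 0) => // i _; apply: zV; lia.
have bV (P : pred int) : exists N : nat, forall i : int, (N < `|i|)%N ->
    is_zero (if P i then V i else zob A).
  have [N hN] := cbounded V; exists N => i hi.
  by case: ifP => _; [exact: hN|exact: zobP].
pose V1 := graded (bV (pred1 m)); pose V2 := graded (bV (predC1 m)).
apply: (@add_iso _ _ (csum V1 V2)).
  apply: graded_diso => // [i j|i] /=.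
    by rewrite !compm0 !comp0m addr0.
  by case: eqP => _ /=; [apply: isomorphic_osuml|apply: isomorphic_osumr]; exact: zobP.
apply: (add_sum (dsum_csum V1 V2)).
  apply/add_incl/(@graded_shift _ m) => //= [i /negPf ->|]; first exact: zobP.
  by rewrite eqxx.
apply: (IH (m + 1)) => //= [i|i hi]; first by case: ifP.
case: eqP => [_|/eqP ni] /=; first exact: zobP.
by apply: zV; move: hi ni; lia.
Qed.

End GradedInX.
End DerivedCategory.

Section Syzygies.
Variable A : abelian.
Implicit Types X Y Z K C P : A.

Fixpoint is_syzygy (n : nat) K : Prop :=
  if n is n'.+1 then
    exists P C (f : Hom K P) (g : Hom P C),
      [/\ projective P, short_exact f g & is_syzygy n' C]
  else True.

(** The recursion of [is_syzygy] peels off the leftmost projective, this one the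
    rightmost. *)
Fixpoint syzygy_from (n : nat) C K : Prop :=
  if n is n'.+1 then
    exists P C' (f : Hom C' P) (g : Hom P C),
      [/\ projective P, short_exact f g & syzygy_from n' C' K]
  else K = C.

Lemma syzygy_from_succ n C C' K P (f : Hom K P) (g : Hom P C') :
  projective P -> short_exact f g -> syzygy_from n C C' -> syzygy_from n.+1 C K.
Proof.
elim: n C => [|n IH] C pP fg /=; first by move=> <-; exists P, K, f, g.
by move=> [P1 [C1 [f1 [g1 [pP1 fg1 /IH h]]]]]; exists P1, C1, f1, g1; split=> //; exact: h.
Qed.

Lemma is_syzygy_from n K : is_syzygy n K -> exists C, syzygy_from n C K.
Proof.
elim: n K => [|n IH] K /=; first by exists K.
move=> [P [C [f [g [pP fg /IH [C' h]]]]]]; exists C'.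
exact: (syzygy_from_succ pP fg h).
Qed.

Lemma syzygy_from_syzygy n C K : syzygy_from n C K -> syzygy n C K.
Proof.
elim: n C => [|n IH] C /=.
  move=> ->; exists (fun=> C), (fun=> idm C); split=> //; first by case.
  by split; [exact: epi_id|by []|exact: mono_id].
move=> [P [C1 [f [g [pP [mf fg eg] /IH]]]]] [E [e [E0 En pE [ee xe me]]]].
subst C1 K.
pose E' i := match i with 0 => C | 1 => P | i.+2 => E i.+1 end.
pose e' i : Hom (E' i.+1) (E' i) :=
  match i with 0 => g | 1 => f \c e 0%N | i.+2 => e i.+1 end.
exists E', e'; split=> //.
  by case=> [|[|i]] //= hi; exact: pE.
split=> //; last by case: n {IH} pE xe me => [|m] _ _ me //=; exact: mono_comp.
case=> [|[|i]] hi /=; last exact: xe.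
  have [gf h] := (exactP _ _).1 fg; apply/exactP; split; first by rewrite compA gf comp0m.
  move=> T y /h [T1 [e1 [x1 [ee1 h1]]]].
  have [T2 [e2 [x2 [ee2 h2]]]] := epi_lift x1 ee.
  exists T2, (e1 \c e2), x2; split; first exact: epi_comp.
  by rewrite -compA h2 compA h1 compA.
have [ee0 h] := (exactP _ _).1 (xe 0%N hi); apply/exactP; split.
  by rewrite -compA ee0 compm0.
by move=> T y; rewrite -compA => /((monoP f).1 mf) /h.
Qed.

Lemma syzygyP n K : is_syzygy n K -> exists C, syzygy n C K.
Proof. by move=> /is_syzygy_from [C /syzygy_from_syzygy]; exists C. Qed.

Lemma is_syzygy_osum n P K : projective P -> is_syzygy n K -> is_syzygy n (osum P K).
Proof.
case: n => //= n pP [Q [C [f [g [pQ [mf /exactP [gf fg] eg] sC]]]]].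
exists (osum P Q), C, (in1 _ _ \c pr1 _ _ + in2 _ _ \c f \c pr2 _ _), (g \c pr2 _ _).
split=> //; first exact: osum_projective.
have pr1E T (x : Hom T (osum P K)) :
    pr1 _ _ \c ((in1 P Q \c pr1 P K + in2 P Q \c f \c pr2 P K) \c x) = pr1 _ _ \c x.
  by rewrite compDl compDr -!compA !osumE addr0.
have pr2E T (x : Hom T (osum P K)) :
    pr2 _ _ \c ((in1 P Q \c pr1 P K + in2 P Q \c f \c pr2 P K) \c x) = f \c (pr2 _ _ \c x).
  by rewrite compDl compDr -!compA !osumE add0r.
split.
- apply/monoP => T x x0; apply: osum_ext; first by rewrite -pr1E x0 !compm0.
  by apply: mf; rewrite -pr2E x0 !compm0.
- apply/exactP; split=> [|T y].
    by rewrite compDr -!compA !osumE compm0 add0r compA gf comp0m.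
  rewrite -compA => /fg [T' [e [x [ee hx]]]].
  exists T', e, (in1 _ _ \c (pr1 _ _ \c y \c e) + in2 _ _ \c x); split=> //.
  apply: osum_ext; first by rewrite pr1E compDr !osumE addr0 compA.
  by rewrite pr2E [in LHS]compDr !osumE add0r hx compA.
- by apply: (@epi_of_comp _ _ _ _ _ (in2 _ _)); rewrite -compA osumE compm1.
Qed.

Record imfact X Y (f : Hom X Y) := Imfact {
  im : A;
  imp : Hom X im;
  imm : Hom im Y;
  imp_epi : epi imp;
  imm_mono : mono imm;
  imE : f = imm \c imp }.

Definition im_syzygy n X Y (f : Hom X Y) : Prop :=
  exists F : imfact f, is_syzygy n (im F).

Definition cok_syzygy n X Y (f : Hom X Y) : Prop :=
  exists C (c : Hom Y C), [/\ epi c, exact f c & is_syzygy n C].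

Lemma projective_cover X : enough_projectives A ->
  exists P (e : Hom P X), [/\ projective P, epi e & is_zero X -> is_zero P].
Proof.
move=> /(_ X) [P [e [pP ee]]]; have [zX|nX] := pselect (is_zero X).
  by exists X, (idm X); split=> //; [exact: zero_projective|exact: epi_id].
by exists P, e.
Qed.

End Syzygies.

Section ComplexSyzygy.
Variables (A : abelian) (N : cplx A) (P : int -> A) (eps : forall i, Hom (P i) (N i)).
Hypotheses (pP : forall i, projective (P i)) (ee : forall i, epi (eps i)).
Hypothesis zP : forall i, is_zero (N i) -> is_zero (P i).

Definition pb_eq i : Hom (osum (P (i + 1)) (P i)) (N (i + 1)) :=
  eps (i + 1) \c pr1 _ _ - cd N i (i + 1) \c eps i \c pr2 _ _.

(** The pullback of [P (i + 1)] and [P i] over [N (i + 1)]; with the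
    differential [(p, q) |-> (0, p)] these form a complex that
    [(p, q) |-> eps q] maps quasi-isomorphically to [N]. *)
Definition pb i : A := ker (pb_eq i).
Definition pbp i : Hom (pb i) (P (i + 1)) := pr1 _ _ \c kerm (pb_eq i).
Definition pbq i : Hom (pb i) (P i) := pr2 _ _ \c kerm (pb_eq i).

Lemma pb_comm i : eps (i + 1) \c pbp i = cd N i (i + 1) \c (eps i \c pbq i).
Proof.
apply/eqP; rewrite -subr_eq0 !compA -compBl; apply/eqP; exact: (kermP (pb_eq i)).1.
Qed.

Lemma pb_ext i T (x y : Hom T (pb i)) :
  pbp i \c x = pbp i \c y -> pbq i \c x = pbq i \c y -> x = y.
Proof.
rewrite -!compA => h1 h2; apply: (@kerm_mono _ _ _ (pb_eq i)).
exact: osum_ext.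
Qed.

Lemma pb_pair i T (a : Hom T (P (i + 1))) (b : Hom T (P i)) :
  eps (i + 1) \c a = cd N i (i + 1) \c (eps i \c b) ->
  exists x : Hom T (pb i), pbp i \c x = a /\ pbq i \c x = b.
Proof.
move=> h; have h0 : pb_eq i \c (in1 _ _ \c a + in2 _ _ \c b) = 0.
  rewrite compDr !compBl -!compA !osumE !compm0 subr0 sub0r h.
  exact: subrr.
have [x [hx _]] := (kermP _).2 _ _ h0.
by exists x; rewrite /pbp /pbq -!compA hx !compDr !osumE addr0 add0r.
Qed.

Lemma pb_diff_ex i : exists d : Hom (pb i) (pb (i + 1)),
  pbp (i + 1) \c d = 0 /\ pbq (i + 1) \c d = pbp i.
Proof. by apply: pb_pair; rewrite pb_comm compA cdd compm0 comp0m. Qed.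

Definition pb_diff i := projT1 (cid (pb_diff_ex i)).

Lemma pbp_diff i : pbp (i + 1) \c pb_diff i = 0.
Proof. by case: (projT2 (cid (pb_diff_ex i))). Qed.

Lemma pbq_diff i : pbq (i + 1) \c pb_diff i = pbp i.
Proof. by case: (projT2 (cid (pb_diff_ex i))). Qed.

Lemma pb_diff2 i : pb_diff (i + 1) \c pb_diff i = 0.
Proof.
by apply: pb_ext; rewrite compm0 compA ?pbp_diff ?comp0m // pbq_diff pbp_diff.
Qed.

Lemma pb_bounded : exists M : nat, forall i : int, (M < `|i|)%N -> is_zero (pb i).
Proof.
have [M hM] := cbounded N; exists M.+1 => i hi.
apply: (mono_zero (@kerm_mono _ _ _ (pb_eq i))).
by apply: osum_zero; apply/zP/hM; move: hi; lia.
Qed.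

Definition pb_cplx : cplx A := seq_cplx pb_diff2 pb_bounded.

Lemma pb_map_comm i j :
  (eps j \c pbq j) \c cd pb_cplx i j = cd N i j \c (eps i \c pbq i).
Proof.
apply: (@cmap_comm_next _ pb_cplx N (fun i => eps i \c pbq i)) => {}i.
by rewrite seq_cplxE -compA pbq_diff pb_comm.
Qed.

Definition pb_map : cmap pb_cplx N := Cmap pb_map_comm.

Lemma pb_map_qis : qis pb_map.
Proof.
apply/qisP => n; rewrite /qis_at !seq_cplxE; split=> [T x y dx xy|T y dy].
  have px : pbp (n + 1) \c x = 0 by rewrite -pbq_diff -compA dx compm0.
  have [T' [e [y' [ee' hy]]]] := epi_lift y (@ee n).
  have [|w [w1 w2]] := @pb_pair n _ (pbq (n + 1) \c x \c e) y'.
    by rewrite hy !compA -xy /= /pbq !compA.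
  exists T', e, w; split=> //; apply: pb_ext.
    by rewrite !compA pbp_diff px !comp0m.
  by rewrite compA pbq_diff w1 compA.
have [T' [e [y' [ee' hy]]]] := epi_lift y (@ee (n + 1)).
have [|x [x1 x2]] := @pb_pair (n + 1) _ 0 y'.
  by rewrite compm0 hy compA dy comp0m.
exists T', e, x, 0; split=> //.
  by apply: pb_ext; rewrite compA ?pbp_diff ?comp0m ?pbq_diff ?x1 compm0.
by rewrite /= compm0 addr0 -compA x2 hy.
Qed.

Lemma pb_ker_syzygy n i :
  im_syzygy n (cd N i (i + 1)) -> is_syzygy n.+1 (ker (cd pb_cplx i (i + 1))).
Proof.
rewrite seq_cplxE => -[[I p m ep mm dE] sI]; set k := kerm (pb_diff i).
exists (P i), I, (pbq i \c k), (p \c eps i); split=> //.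
have pk : pbp i \c k = 0 by rewrite -pbq_diff -compA (kermP _).1 compm0.
split; last by apply: epi_comp.
  apply/monoP => T x; rewrite -compA => x0; apply: (@kerm_mono _ _ _ (pb_diff i)).
  by apply: pb_ext; rewrite compm0 ?x0 compm0 // compA pk comp0m.
apply/exactP; split=> [|T y y0].
  have h : cd N i (i + 1) \c (eps i \c pbq i) \c k = 0.
    by rewrite -pb_comm -compA pk compm0.
  by apply: (mm); rewrite compm0 -h dE !compA.
have [|x [x1 x2]] := @pb_pair i _ 0 y.
  by rewrite compm0 dE -compA (compA p) y0 compm0.
have [|z [hz _]] := (kermP (pb_diff i)).2 _ x.
  by apply: pb_ext; rewrite compA ?pbp_diff ?pbq_diff ?comp0m ?x1 compm0.
by exists T, (idm T), z; split; [exact: epi_id|rewrite -compA hz x2 compm1].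
Qed.

Lemma pb_im_syzygy n i :
  cok_syzygy n (cd N i (i + 1)) -> im_syzygy n.+1 (cd pb_cplx i (i + 1)).
Proof.
rewrite seq_cplxE => -[C [c [ec /exactP [cd0 hc] sC]]].
have [I [p [m [ep mm dE]]]] := image_fact (pb_diff i).
exists (Imfact ep mm dE), (P (i + 1)), C, (pbq (i + 1) \c m), (c \c eps (i + 1)).
have qE : pbq (i + 1) \c m \c p = pbp i by rewrite -compA -dE pbq_diff.
split=> //; split; last exact: epi_comp.
  apply/monoP => T x x0; have [T' [e [w [ee' hw]]]] := epi_lift x ep.
  apply: (epiP e).1 => //; apply: (mm); rewrite -hw compA -dE compm0.
  have pw : pbp i \c w = 0 by rewrite -qE -(compA _ p) hw compA x0 comp0m.
  by apply: pb_ext; rewrite compA ?pbp_diff ?pbq_diff ?comp0m ?pw compm0.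
apply/exactP; split=> [|T y y0].
  apply: (epiP p).1 => //; rewrite -(compA _ (_ \c m)) qE -compA pb_comm (compA c) cd0.
  exact: comp0m.
have [T1 [e1 [z [ee1 hz]]]] : exists T' (e : Hom T' T) x, epi e /\
    cd N i (i + 1) \c x = eps (i + 1) \c y \c e by apply: hc; rewrite compA.
have [T2 [e2 [q [ee2 hq]]]] := epi_lift z (@ee i).
have [|x [x1 x2]] := @pb_pair i _ (y \c e1 \c e2) q.
  by rewrite hq !compA hz.
exists T2, (e1 \c e2), (p \c x); split; first exact: epi_comp.
by rewrite (compA _ p) qE x1 compA.
Qed.

End ComplexSyzygy.

Section Cones.
Variables (A : abelian) (X Y : cplx A) (f : cmap X Y).

Lemma pr1_cone i T (x : Hom T (cone f i)) :
  pr1 _ _ \c (cd (cone f) i (i + 1) \c x) = - (cd X (i + 1) (i + 1 + 1) \c (pr1 _ _ \c x)).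
Proof.
by rewrite /= /cone_d !compDl !compDr -!compA !osumE !addr0 compNm.
Qed.

Lemma pr2_cone i T (x : Hom T (cone f i)) :
  pr2 _ _ \c (cd (cone f) i (i + 1) \c x) =
  f (i + 1) \c (pr1 _ _ \c x) + cd Y i (i + 1) \c (pr2 _ _ \c x).
Proof.
by rewrite /= /cone_d kronE compm1 !compDl !compDr -!compA !osumE add0r.
Qed.

End Cones.

Section Generation.
Variable A : abelian.
Hypothesis hA : enough_projectives A.
Implicit Types M N : cplx A.

Definition ker_im_syzygies n M : Prop := forall i,
  is_syzygy n (ker (cd M i (i + 1))) /\ im_syzygy n (cd M i (i + 1)).

Lemma syzygy_replacement n N :
  (forall i, im_syzygy n (cd N i (i + 1)) /\ cok_syzygy n (cd N i (i + 1))) ->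
  exists W, disomorphic W N /\ ker_im_syzygies n.+1 W.
Proof.
move=> hN; pose P i := projT1 (cid (projective_cover (N i) hA)).
pose eps i : Hom (P i) (N i) := projT1 (cid (projT2 (cid (projective_cover (N i) hA)))).
have PP i : [/\ projective (P i), epi (eps i) & is_zero (N i) -> is_zero (P i)] :=
  projT2 (cid (projT2 (cid (projective_cover (N i) hA)))).
have ee i : epi (eps i) by case: (PP i).
have pP i : projective (P i) by case: (PP i).
have zP i : is_zero (N i) -> is_zero (P i) by case: (PP i).
exists (pb_cplx eps zP); split; first exact: disomorphic_qis (pb_map_qis ee zP).
by move=> i; have [h1 h2] := hN i; split; [exact: pb_ker_syzygy|exact: pb_im_syzygy].
Qed.

Lemma cone_projective_cover n M : ker_im_syzygies n.+1 M ->
  exists (Q : cplx A) (f : cmap Q M),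
    [/\ forall i j, cd Q i j = 0, forall i, projective (Q i)
      & forall i, im_syzygy n.+1 (cd (cone f) i (i + 1)) /\
                  cok_syzygy n.+1 (cd (cone f) i (i + 1))].
Proof.
move=> hM; pose K i := ker (cd M i (i + 1)); pose k i : Hom (K i) (M i) := kerm _.
have mk i : mono (k i) by exact: kerm_mono.
have dk i : cd M i (i + 1) \c k i = 0 by case: (kermP (cd M i (i + 1))).
pose Q i := projT1 (cid (projective_cover (K i) hA)).
pose q i : Hom (Q i) (K i) := projT1 (cid (projT2 (cid (projective_cover (K i) hA)))).
have QP i : [/\ projective (Q i), epi (q i) & is_zero (K i) -> is_zero (Q i)] :=
  projT2 (cid (projT2 (cid (projective_cover (K i) hA)))).
have bQ : exists N : nat, forall i : int, (N < `|i|)%N -> is_zero (Q i).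
  have [N hN] := cbounded M; exists N => i hi; have [_ _] := QP i; apply.
  exact: mono_zero (@mk i) (hN i hi).
have fP i j : (k j \c q j) \c cd (graded bQ) i j = cd M i j \c (k i \c q i).
  apply: (@cmap_comm_next _ (graded bQ) M (fun i => k i \c q i)) => {}i.
  by rewrite compm0 compA dk comp0m.
exists (graded bQ), (Cmap fP); split=> // [i|i]; first by case: (QP i).
set f := Cmap fP; split.
  have [r [rE _]] := (kermP (cd M (i + 1) (i + 1 + 1))).2 _ _ (cdd M i (i + 1) (i + 1 + 1)).
  pose p : Hom (cone f i) (K (i + 1)) := q (i + 1) \c pr1 _ _ + r \c pr2 _ _.
  have ep : epi p.
    have [_ eq _] := QP (i + 1).
    by apply: (@epi_of_comp _ _ _ _ _ (in1 _ _)); rewrite compDl -!compA !osumE compm0 compm1 addr0.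
  have mm : mono (in2 (Q (i + 1 + 1)) (M (i + 1)) \c k (i + 1)).
    apply: mono_comp => //; apply: (@mono_of_comp _ _ _ _ (pr2 _ _)).
    by rewrite osumE; exact: mono_id.
  have dE : cd (cone f) i (i + 1) = in2 (Q (i + 1 + 1)) (M (i + 1)) \c k (i + 1) \c p.
    rewrite -[LHS]compm1; apply: osum_ext.
      by rewrite pr1_cone comp0m oppr0 -!compA osumE.
    rewrite pr2_cone !compm1 -!compA osumE compDr !compA.
    by congr (_ + _ \c _); rewrite rE.
  by exists (Imfact ep mm dE); case: (hM (i + 1)).
have [_ [[I p m ep mm dE] sI]] := hM (i + 1).
pose c : Hom (cone f (i + 1)) (osum (Q (i + 1 + 1)) I) :=
  in1 _ _ \c pr1 _ _ + in2 _ _ \c p \c pr2 _ _.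
have pr1c T (x : Hom T (cone f (i + 1))) : pr1 _ _ \c (c \c x) = pr1 _ _ \c x.
  by rewrite compDl compDr -!compA !osumE addr0.
have pr2c T (x : Hom T (cone f (i + 1))) : pr2 _ _ \c (c \c x) = p \c (pr2 _ _ \c x).
  by rewrite compDl compDr -!compA !osumE add0r.
exists (osum (Q (i + 1 + 1)) I), c; split.
- apply/epiP => T u uc; apply: osum_eq; rewrite comp0m.
    have := congr1 (fun v => v \c in1 _ _) uc; rewrite comp0m => <-.
    by rewrite -!compA compDl -!compA !osumE !compm0 addr0 compm1.
  apply: (epiP p).1 => //.
  have := congr1 (fun v => v \c in2 _ _) uc; rewrite comp0m => <-.
  by rewrite -!compA compDl -!compA !osumE !compm0 add0r compm1.
- apply/exactP; split=> [|T y cy].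
    rewrite -[LHS]compm1 -compA; apply: osum_ext.
      by rewrite pr1c pr1_cone comp0m oppr0 compm0.
    apply: (mm); rewrite pr2c compA -dE pr2_cone compDr !compA dk cdd.
    by rewrite !comp0m addr0 !compm0.
  have y1 : pr1 _ _ \c y = 0 by rewrite -pr1c cy compm0.
  have [z [zE _]] : exists! z, k (i + 1) \c z = pr2 _ _ \c y.
    by apply: (kermP _).2; rewrite dE -compA -pr2c cy !compm0.
  have [_ eq _] := QP (i + 1).
  have [T' [e [x [ee hx]]]] := epi_lift z eq.
  exists T', e, (in1 _ _ \c x); split=> //; apply: osum_ext.
    by rewrite pr1_cone comp0m oppr0 compA y1 comp0m.
  by rewrite pr2_cone !osumE compm0 addr0 /= -compA hx compA zE compA.
- by apply: is_syzygy_osum => //; case: (QP (i + 1 + 1)).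
Qed.

Variable S : A -> Prop.
Hypothesis SP : forall P, projective P -> S P.

Lemma star_ker_im M :
  (forall i, S (ker (cd M i (i + 1)))) ->
  (forall i, exists F : imfact (cd M i (i + 1)), S (im F)) ->
  star (add (shifts (in_deg0 S))) (add (shifts (in_deg0 S))) M.
Proof.
move=> SK SI; have [N hN] := cbounded M.
pose K i := ker (cd M i (i + 1)); pose k i : Hom (K i) (M i) := kerm _.
have mk i : mono (k i) by exact: kerm_mono.
have dk i : cd M i (i + 1) \c k i = 0 by case: (kermP (cd M i (i + 1))).
pose F i := projT1 (cid (SI i)).
have SF i : S (im (F i)) := projT2 (cid (SI i)).
have bK : exists N : nat, forall i : int, (N < `|i|)%N -> is_zero (K i).
  by exists N => i hi; apply: mono_zero (@mk i) (hN i hi).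
have bI : exists N : nat, forall i : int, (N < `|i|)%N -> is_zero (im (F i)).
  by exists N => i hi; apply: epi_zero (@imp_epi _ _ _ _ (F i)) (hN i hi).
have fP i j : k j \c cd (graded bK) i j = cd M i j \c k i.
  by apply: (@cmap_comm_next _ (graded bK) M k) => {}i; rewrite compm0 dk.
pose f : cmap (graded bK) M := Cmap fP.
have pd i T (x : Hom T (cone f i)) :
    imp (F (i + 1)) \c (pr2 _ _ \c (cd (cone f) i (i + 1) \c x)) = 0.
  apply: (@imm_mono _ _ _ _ (F (i + 1))); rewrite compA -imE compm0 pr2_cone.
  by rewrite compDr !compA dk cdd !comp0m addr0.
have gP i j : (imp (F j) \c pr2 _ _) \c cd (cone f) i j =
              cd (graded bI) i j \c (imp (F i) \c pr2 _ _).
  apply: (@cmap_comm_next _ (cone f) (graded bI) (fun i => imp (F i) \c pr2 _ _)) => {}i.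
  by rewrite comp0m -[LHS]compm1 -!compA pd.
pose g : cmap (cone f) (graded bI) :=
  @Cmap A (cone f) (graded bI) (fun i => imp (F i) \c pr2 _ _) gP.
have qg : qis g.
  apply/qisP => n; split=> [T x y dx gx|T y _].
    have px : imp (F (n + 1)) \c (pr2 _ _ \c x) = 0 by rewrite compA gx comp0m.
    have d2 : cd M (n + 1) (n + 1 + 1) \c (pr2 _ _ \c x) = 0.
      by rewrite (imE (F (n + 1))) -compA px compm0.
    have x1 : pr1 _ _ \c x = 0.
      apply: (@mk (n + 1 + 1)); have := @pr2_cone A _ _ f _ _ x.
      by rewrite dx d2 addr0 !compm0 => <-.
    have [z [zE _]] := (kermP _).2 _ _ d2.
    exists T, (idm T), (in1 _ _ \c z); split; first exact: epi_id.
    rewrite compm1; apply: osum_ext; first by rewrite pr1_cone comp0m oppr0 x1.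
    by rewrite pr2_cone !osumE compm0 addr0.
  have [T' [e [m [ee hm]]]] := epi_lift y (@imp_epi _ _ _ _ (F (n + 1))).
  have [z [zE _]] : exists! z, k (n + 1 + 1) \c z = - (cd M (n + 1) (n + 1 + 1) \c m).
    by apply: (kermP _).2; rewrite compmN compA cdd comp0m oppr0.
  exists T', e, (in1 _ _ \c z + in2 _ _ \c m), 0; split=> //.
    apply: osum_ext; first by rewrite pr1_cone comp0m oppr0 compm0.
    by rewrite pr2_cone !compDr !osumE !compm0 addr0 add0r zE addNr.
  by rewrite compm0 addr0 /= -compA compDr !osumE add0r hm.
have S0 : S (zob A) by apply/SP/zero_projective/zobP.
apply: (@star_cone _ _ _ _ _ f); first exact: graded_add.
apply: add_diso (disomorphic_sym (disomorphic_qis qg)) _.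
exact: graded_add.
Qed.

Lemma iter_star_syzygies d (sS : forall K, is_syzygy d K -> S K) n k M :
  (n + k.+1)%N = d -> ker_im_syzygies k.+1 M ->
  iter n.+1 (star (add (shifts (in_deg0 S)))) (add (shifts (in_deg0 S))) M.
Proof.
elim: n k M => [|n IH] k M nk hM.
  apply: star_ker_im => i; have [h1 [F h2]] := hM i; first by apply: sS; rewrite -nk.
  by exists F; apply: sS; rewrite -nk.
have [Q [f [dQ pQ /syzygy_replacement [W [WN hW]]]]] := cone_projective_cover hM.
rewrite iterS; apply: (@star_cone _ _ _ _ _ f).
  by apply: graded_add => // [|i]; apply: SP => //; exact/zero_projective/zobP.
apply: iter_star_diso WN _; apply: (IH k.+1) => //; by rewrite -nk addnS.
Qed.

Lemma gen_syzygies d (sS : forall K, is_syzygy d.+1 K -> S K) M :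
  gen (in_deg0 S) d.+2 M.
Proof.
have [|W [WM hW]] := @syzygy_replacement 0 M.
  move=> i; have [I [p [m [ep mm dE]]]] := image_fact (cd M i (i + 1)).
  split; first by exists (Imfact ep mm dE).
  exists (cok (cd M i (i + 1))), (cokm _); split=> //; first exact: cokm_epi.
  exact: cokm_exact.
apply: add_iso WM _; apply: add_incl.
by apply: (iter_star_syzygies sS) hW; rewrite addn1.
Qed.

Lemma tri_dim_le (T : cplx A -> Prop) n :
  (forall M, gen T n.+1 M) -> (tri_dim T <= (Posz n)%:E)%E.
Proof.
move=> h; rewrite /tri_dim; case: pselect => [ex|[]]; last by exists n; apply/asboolP.
by rewrite lee_fin lez_nat; case: ex_minnP => m _; apply; apply/asboolP.
Qed.

End Generation.

Theorem theorem1p3 (A : abelian) (hA : enough_projectives A) (d : nat)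
    (X : A -> Prop) (hX : resolving X)
    (hsyz : forall C K : A, syzygy d C K -> X K) :
  (tri_dim (in_deg0 X) <= (Posz (maxn 1 d))%:E)%E.
Proof.
have -> : maxn 1 d = d.-1.+1 by lia.
apply: tri_dim_le => M; apply: gen_syzygies => // [|K].
  exact: res_proj.
case: d hsyz => [|d] hsyz; first by move=> _; apply: hsyz; exact: (@syzygy_from_syzygy A 0 K K).
by move=> /(@syzygyP A d.+1) [C]; exact: hsyz.
Qed.
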